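(* Let $L>0$, $\beta>0$. Let $f:[0,\infty)\to\mathbb{R}$ be a strictly increasing function with $f\in C^2((0,\infty))$, $\beta\in f((0,\infty))$ and $f''(f^{-1}(\beta))>0$. Let $$A_{f,L,\beta}=\Big\{b\in L^1_{\rm loc}(\mathbb{R})\ \Big|\ b(\cdot+L)=b(\cdot),\ b\ge 0,\ \frac1L\int_0^L f(b)\,dx=\beta\Big\},$$ let $b_0:=f^{-1}(\beta)$ (constant function), and $$D(\beta):=2f''(f^{-1}(\beta))\Big(\frac{\pi^2}{L^2}+f^{-1}(\beta)\Big)-f'(f^{-1}(\beta)).$$ If $D(\beta)>0$, then $b_0$ is a local maximizer of $c^*$ in $A_{f,L,\beta}$; namely, there is an $\eta>0$ such that $$c^*(b_0)>c^*(b)\quad\text{for all } b\in A_{f,L,\beta}\text{ with }0<\|b_0-b\|_{L^\infty}\le\eta.$$ If $D(\beta)<0$, then $b_0$ is neither a local maximizer nor a local minimizer of $c^*$ in $A_{f,L,\beta}$.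
   Context: For $\lambda\in\mathbb{R}$ and a real $L$-periodic function $b\in L^1_{\rm loc}(\mathbb{R})$, $k(\lambda,b)\in\mathbb{R}$ denotes the principal eigenvalue of $-L_{\lambda,b}\psi:=-\psi''-2\lambda\psi'-(b(x)+\lambda^2)\psi$ on $\mathbb{R}/L\mathbb{Z}$, i.e. the unique real number for which $-L_{\lambda,b}\psi=k(\lambda,b)\psi$ has an $L$-periodic positive solution $\psi$. For $b\ge0$, $b\not\equiv0$, the minimal speed of pulsating traveling waves of $u_t=u_{xx}+b(x)(1-u)u$ is $c^*(b)=\min_{\lambda>0}\frac{-k(\lambda,b)}{\lambda}$. ''Local'' is meant with respect to $L^\infty$-perturbations, i.e. the distance $\|b-b_0\|_{L^\infty}$. *)

(* Defs.v *)
(* MathComp-Analysis, over an abstract [R : realType]. *)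
From HB Require Import structures.
From mathcomp Require Import all_boot all_order all_algebra.
From mathcomp Require Import all_classical all_reals all_analysis.

Set Implicit Arguments.
Unset Strict Implicit.
Unset Printing Implicit Defensive.

Import Order.TTheory GRing.Theory Num.Theory.
Import numFieldNormedType.Exports.

Local Open Scope classical_set_scope.
Local Open Scope ring_scope.

Definition periodic {R : realType} (L : R) (g : R -> R) : Prop :=
  forall x, g (x + L) = g x.

(* Since [b] is only locally integrable, solutions are taken in W^{2,1}_loc:
   [psi] is differentiable, [derive1 psi] is a primitive of the locally integrable
   function [psi2] (the weak second derivative), and the equation
     - psi'' - 2 lambda psi' - (b + lambda^2) psi = k psi
   holds almost everywhere. *)
Definition weak_second_derivative {R : realType} (psi psi2 : R -> R) : Prop :=
  [/\ forall x, derivable psi x 1,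
      locally_integrable setT psi2 &
      forall x y, x <= y ->
        derive1 psi y - derive1 psi x =
        \int[@lebesgue_measure R]_(t in `[x, y]) psi2 t].

Definition eigen_equation {R : realType} (lambda : R) (b : R -> R) (k : R)
    (psi : R -> R) : Prop :=
  exists2 psi2, weak_second_derivative psi psi2 &
    {ae @lebesgue_measure R, forall x,
      - psi2 x - 2 * lambda * derive1 psi x - (b x + lambda ^+ 2) * psi x
      = k * psi x}.

Definition is_principal_eigenvalue {R : realType} (L lambda : R) (b : R -> R)
    (k : R) : Prop :=
  exists psi : R -> R,
    [/\ periodic L psi, forall x, 0 < psi x & eigen_equation lambda b k psi].

(* [xget 0 P] is some element of [P], and 0 if there is none. *)
Definition principal_eigenvalue {R : realType} (L lambda : R) (b : R -> R) : R :=
  xget 0 [set k | is_principal_eigenvalue L lambda b k].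

Definition speeds {R : realType} (L : R) (b : R -> R) : set R :=
  [set - principal_eigenvalue L lambda b / lambda | lambda in `]0, +oo[].

(* [S `&` lbound S] consists of the minimum of [S], if it is attained. *)
Definition minimal_speed {R : realType} (L : R) (b : R -> R) : R :=
  xget 0 (speeds L b `&` lbound (speeds L b)).

(* Elements of L^1_loc are represented by Borel functions whose periodicity and
   nonnegativity hold everywhere; every class whose periodicity and
   nonnegativity hold almost everywhere has such a representative. *)
Definition admissible {R : realType} (f : R -> R) (L beta : R) :
    set (R -> R) :=
  [set b | [/\ locally_integrable setT b,
               periodic L b,
               forall x, 0 <= b x,
               integrable (@lebesgue_measure R) `[0, L]
                 (fun x => (f (b x))%:E) &
               L^-1 * \int[@lebesgue_measure R]_(x in `[0, L]) f (b x)
               = beta]].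

Definition Linfty_dist {R : realType} (b1 b2 : R -> R) : \bar R :=
  Lnorm (@lebesgue_measure R) +oo%E (fun x => (b1 x - b2 x)%:E).

Definition strict_local_maximizer {R : realType} (c : (R -> R) -> R)
    (A : set (R -> R)) (b0 : R -> R) : Prop :=
  exists2 eta : R, 0 < eta &
    forall b, A b ->
      (0 < Linfty_dist b0 b)%E -> (Linfty_dist b0 b <= eta%:E)%E -> c b < c b0.

Definition local_maximizer {R : realType} (c : (R -> R) -> R)
    (A : set (R -> R)) (b0 : R -> R) : Prop :=
  exists2 eta : R, 0 < eta &
    forall b, A b -> (Linfty_dist b0 b <= eta%:E)%E -> c b <= c b0.

Definition local_minimizer {R : realType} (c : (R -> R) -> R)
    (A : set (R -> R)) (b0 : R -> R) : Prop :=
  exists2 eta : R, 0 < eta &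
    forall b, A b -> (Linfty_dist b0 b <= eta%:E)%E -> c b0 <= c b.

Definition inv_nonneg {R : realType} (f : R -> R) (beta : R) : R :=
  pinv (`[0, +oo[ : set R) f beta.

Definition Dbeta {R : realType} (f : R -> R) (L beta : R) : R :=
  2 * derive1n 2 f (inv_nonneg f beta) * (pi ^+ 2 / L ^+ 2 + inv_nonneg f beta)
  - derive1 f (inv_nonneg f beta).

(* Main.v *)
Require Import Defs.
From mathcomp Require Import all_boot all_order all_algebra.
From mathcomp Require Import all_classical all_reals all_analysis.
From mathcomp Require Import measurable_realfun ess_sup_inf ring lra.
Import Order.TTheory GRing.Theory Num.Theory.
Import numFieldNormedType.Exports.
Local Open Scope classical_set_scope.
Local Open Scope ring_scope.

Set Implicit Arguments.
Unset Strict Implicit.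
Unset Printing Implicit Defensive.

(**
If psi is a principal eigenfunction for lambda, p = psi' / psi is a periodic
function of zero mean, and with v = b - b0 and m = - k - lambda^2 - b0 it solves
  p' = m - v - 2 lambda p - p^2,
so that m = mean v + mean p^2. The constraint mean f(b) = beta gives
mean v ~ - f''(b0) / (2 f'(b0)) mean v^2, while to leading order
  mean p^2 ~ sum_n |v_n|^2 / ((2 pi n / L)^2 + 4 lambda^2)
over the Fourier modes of v; at lambda^2 = b0 the mode n = 1 weighs
1 / (4 (pi^2 / L^2 + b0)), and D is positive iff the negative contribution of mean v
wins on this mode.

D > 0: testing the equation with p' bounds p uniformly, Wirtinger's inequality
bounds mean p^2 from above, and m < 0 at the single value lambda = sqrt b0 gives
c(b) < 2 sqrt b0 = c(b0).

D < 0: take v = e cos (2 pi n x / L) + t with t fixed by the constraint. For large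
n, mean p^2 is negligible and m < 0. For n = 1, testing with the cosine bounds
mean p^2 from below for every lambda, whence - k > 2 lambda sqrt b0. Here the
existence of the eigenvalues is needed for all lambda > 0 and a fixed v: the
periodic solution of p' + 2 lambda p = g of zero mean is bounded by 2 L sup |g|,
uniformly in lambda, so the Riccati equation is solved by a contraction. The minimum
over lambda is attained, as k is continuous: a periodic d with d' + a d > 0 cannot
have zero mean.
*)

(** * Integrals of bounded functions on a segment *)

(** Since [b] is only measurable, [p] is merely Lipschitz and its equation holds only in integrated
    form. All calculus on the period is therefore done with increments, and the product rule for
    such primitives replaces integration by parts. The Riccati form makes every estimate an exact
    integral identity followed by an inequality. These estimates apply to any eigenvalue of the
    given [b], so no uniqueness result or expansion of [k] in [v] enters. The two halves of the
    claim are not symmetric because of the default value 0 of [xget]. An upper bound on the speed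
    survives a missing eigenvalue or minimum, as 0 lies below 2 sqrt b0, so arbitrary measurable [b]
    can be treated without an existence theory. A lower bound does not survive it, and there
    existence is proved for the continuous perturbations that serve as counterexamples. Wirtinger's
    constant is approached from below, and all error terms are absorbed by the strictness of the
    sign of D. *)

Notation Int a b g := (\int[@lebesgue_measure _]_(x in `[a, b]) g x).

(** Boundedness is preferred to integrability because it is stable under products and powers, which
    the quadratic and cubic integrands of the Riccati estimates require. *)
Definition bddmeas {R : realType} (a b : R) (g : R -> R) : Prop :=
  measurable_fun `[a, b] g /\ exists M, forall x, a <= x <= b -> `|g x| <= M.

Lemma bddmeas_integrable {R : realType} (a b : R) g : bddmeas a b g ->
  lebesgue_measure.-integrable `[a, b] (EFin \o g).
Proof.
move=> [mg [M gM]]; apply: measurable_bounded_integrable => //.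
- by move=> /=; rewrite lebesgue_measure_itv/=; case: ifP => _; rewrite ?ltry.
- exists M; split; first exact: num_real.
  move=> y My x /=; rewrite in_itv /= => xab.
  exact: le_trans (gM _ xab) (ltW My).
Qed.

Lemma bddmeas_sub {R : realType} (a b c d : R) g : a <= c -> d <= b -> bddmeas a b g -> bddmeas c d g.
Proof.
move=> ac db [mg [M gM]]; split.
  apply: measurable_funS mg => //; apply: subset_itv; by rewrite bnd_simp.
by exists M => x /andP[cx xd]; apply: gM; lra.
Qed.

Lemma bddmeas_cst {R : realType} (a b c : R) : bddmeas a b (fun=> c).
Proof. by split; [exact: measurable_cst|exists `|c|]. Qed.

Lemma bddmeasD {R : realType} (a b : R) f g : bddmeas a b f -> bddmeas a b g -> bddmeas a b (fun x => f x + g x).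
Proof.
move=> [mf [M fM]] [mg [N gN]]; split; first exact: measurable_funD.
exists (M + N) => x xab; apply: le_trans (ler_normD _ _) _.
by apply: lerD; [exact: fM|exact: gN].
Qed.

Lemma bddmeasN {R : realType} (a b : R) f : bddmeas a b f -> bddmeas a b (fun x => - f x).
Proof.
move=> [mf [M fM]]; split; first exact: measurableT_comp.
by exists M => x xab; rewrite normrN; exact: fM.
Qed.

Lemma bddmeasB {R : realType} (a b : R) f g : bddmeas a b f -> bddmeas a b g -> bddmeas a b (fun x => f x - g x).
Proof. by move=> hf hg; apply: (bddmeasD hf); exact: bddmeasN. Qed.

Lemma bddmeasM {R : realType} (a b : R) f g : bddmeas a b f -> bddmeas a b g -> bddmeas a b (fun x => f x * g x).
Proof.
move=> [mf [M fM]] [mg [N gN]]; split; first exact: measurable_funM.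
exists (M * N) => x xab; rewrite normrM.
by apply: ler_pM => //; [exact: fM|exact: gN].
Qed.

Lemma bddmeasX {R : realType} (a b : R) f n : bddmeas a b f -> bddmeas a b (fun x => f x ^+ n).
Proof.
move=> hf; elim: n => [|n IH]; first exact: bddmeas_cst.
by under eq_fun do rewrite exprS; exact: bddmeasM.
Qed.

Ltac bddmeas_tac := repeat first [assumption | apply: bddmeas_cst | apply: bddmeasX | apply: bddmeasD | apply: bddmeasN | apply: bddmeasM].

Lemma bddmeas_norm {R : realType} (a b : R) f : bddmeas a b f -> bddmeas a b (fun x => `|f x|).
Proof.
move=> [mf [M fM]]; split; first exact: measurableT_comp.
by exists M => x xab; rewrite normr_id; exact: fM.
Qed.

Lemma within_continuous_bounded {R : realType} (a b : R) (f : R -> R) :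
  {within `[a, b], continuous f} -> exists M, forall x, a <= x <= b -> `|f x| <= M.
Proof.
move=> cf; have := continuous_compact cf (@segment_compact _ a b).
move=> /compact_bounded [M [Mr HM]]; exists (M + 1) => x xab.
by apply: (HM (M + 1)); [lra|exists x].
Qed.

Lemma bddmeas_within {R : realType} (a b : R) (f : R -> R) :
  {within `[a, b], continuous f} -> bddmeas a b f.
Proof.
move=> cf; split; last exact: within_continuous_bounded.
by apply: subspace_continuous_measurable_fun => //; exact: measurable_itv.
Qed.

Lemma bddmeas_cont {R : realType} (a b : R) (f : R -> R) : continuous f -> bddmeas a b f.
Proof. by move=> cf; apply: bddmeas_within; exact: continuous_subspaceT. Qed.

Lemma IntD {R : realType} (a b : R) f g : bddmeas a b f -> bddmeas a b g ->
  Int a b (fun x => f x + g x) = Int a b f + Int a b g.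
Proof. by move=> /bddmeas_integrable hf /bddmeas_integrable hg; rewrite RintegralD. Qed.

Lemma IntB {R : realType} (a b : R) f g : bddmeas a b f -> bddmeas a b g ->
  Int a b (fun x => f x - g x) = Int a b f - Int a b g.
Proof. by move=> /bddmeas_integrable hf /bddmeas_integrable hg; rewrite RintegralB. Qed.

Lemma IntZ {R : realType} (a b c : R) f : bddmeas a b f ->
  Int a b (fun x => c * f x) = c * Int a b f.
Proof. by move=> /bddmeas_integrable hf; rewrite RintegralZl. Qed.

Lemma Int_cst {R : realType} (a b c : R) : a <= b -> Int a b (fun=> c) = c * (b - a).
Proof.
move=> ab; rewrite Rintegral_cst//= lebesgue_measure_itv/= lte_fin.
case: ltP => [//|ba]; have -> : a = b by lra.
by rewrite subrr /= .
Qed.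

Lemma le_Int {R : realType} (a b : R) f g : bddmeas a b f -> bddmeas a b g ->
  (forall x, a <= x <= b -> f x <= g x) -> Int a b f <= Int a b g.
Proof.
move=> /bddmeas_integrable hf /bddmeas_integrable hg fg.
by apply: le_Rintegral.
Qed.

Lemma eq_Int {R : realType} (a b : R) f g :
  (forall x, a <= x <= b -> f x = g x) -> Int a b f = Int a b g.
Proof.
move=> fg; apply: eq_Rintegral => x; rewrite inE /= in_itv; exact: fg.
Qed.

Lemma Int_split {R : realType} (a b c : R) f : a <= b -> b <= c -> bddmeas a c f ->
  Int a c f = Int a b f + Int b c f.
Proof.
move=> ab bc hf.
have := @Rintegral_itvB R f (BLeft a) (BRight c) b (bddmeas_integrable hf).
rewrite !bnd_simp => /(_ ab bc).
rewrite Rintegral_itv_obnd_cbnd; last first.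
  apply: integrableS (bddmeas_integrable hf) => //; apply: subset_itv; by rewrite bnd_simp.
lra.
Qed.

Lemma norm_Int_le {R : realType} (a b M : R) f : a <= b -> bddmeas a b f ->
  (forall x, a <= x <= b -> `|f x| <= M) -> `|Int a b f| <= M * (b - a).
Proof.
move=> ab hf fM; apply: le_trans (le_normr_Rintegral _ (bddmeas_integrable hf)) _ => //.
by rewrite -Int_cst//; apply: le_Int => //; [exact: bddmeas_norm|exact: bddmeas_cst].
Qed.

(** * Lipschitz primitives *)

(** The fundamental theorem of calculus is taken as the definition: [g] is bounded and measurable,
    so [P] is Lipschitz but may fail to be differentiable at some points. *)
Definition primitive_on {R : realType} (a b : R) (P g : R -> R) : Prop :=
  bddmeas a b g /\
  forall x y, a <= x -> x <= y -> y <= b -> P y - P x = Int x y g.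

(** Over n + 1 equal pieces the increments add up to at most C (b - a)^2 / (n + 1), which tends to
    0. *)
Lemma quadratic_increments_cst {R : realType} (a b C : R) (H : R -> R) : a <= b ->
  (forall x y, a <= x -> x <= y -> y <= b -> `|H y - H x| <= C * (y - x) ^+ 2) ->
  H a = H b.
Proof.
move=> ab HC.
have sub n (k : nat) : (k <= n.+1)%N ->
    `|H (a + k%:R * ((b - a) / n.+1%:R)) - H a| <= k%:R * (C * ((b - a) / n.+1%:R) ^+ 2).
  set h := (b - a) / n.+1%:R.
  have h0 : 0 <= h by rewrite divr_ge0// subr_ge0.
  have hb : a + n.+1%:R * h = b by rewrite /h mulrCA divff ?pnatr_eq0// mulr1; lra.
  elim: k => [_|k IH kn]; first by rewrite !mul0r addr0 subrr normr0.
  have kb : k.+1%:R * h <= n.+1%:R * h by rewrite ler_wpM2r// ler_nat.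
  have k0 : 0 <= k%:R * h by rewrite mulr_ge0.
  have -> : H (a + k.+1%:R * h) - H a =
     (H (a + k.+1%:R * h) - H (a + k%:R * h)) + (H (a + k%:R * h) - H a) by ring.
  apply: le_trans (ler_normD _ _) _.
  rewrite [leRHS](_ : _ = C * h ^+ 2 + k%:R * (C * h ^+ 2)); last by rewrite -natr1; ring.
  apply: lerD; last exact: IH (ltnW kn).
  have kE : k.+1%:R * h = k%:R * h + h by rewrite -addn1 natrD; ring.
  apply: le_trans (HC _ _ _ _ _) _; [lra|lra|lra|].
  by rewrite (_ : _ - _ = h)//; lra.
have lim n : `|H b - H a| * n.+1%:R <= C * (b - a) ^+ 2.
  have := sub n n.+1 (leqnn _).
  rewrite (_ : a + _ = b); last by rewrite mulrCA divff ?pnatr_eq0// mulr1; lra.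
  move=> h; have n0 : (0:R) < n.+1%:R by rewrite ltr0n.
  rewrite (_ : C * _ = n.+1%:R * (C * ((b - a) / n.+1%:R) ^+ 2) * n.+1%:R); last first.
    by move: (lt0r_neq0 n0); set N := n.+1%:R => N0; field.
  by rewrite ler_pM2r.
apply/eqP; rewrite eq_sym -subr_eq0 -normr_eq0; apply/negPn/negP => h0.
have {}h0 : 0 < `|H b - H a| by rewrite lt_neqAle eq_sym h0 normr_ge0.
have [n Hn] : exists n : nat, C * (b - a) ^+ 2 / `|H b - H a| < n%:R.
  exists (Num.bound `|C * (b - a) ^+ 2 / `|H b - H a| |).
  by apply: le_lt_trans (ler_norm _) _; exact: archi_boundP.
rewrite ltr_pdivrMr// in Hn; have := lim n.
rewrite -[n.+1]addn1 natrD; nra.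
Qed.

Lemma primitive_on_lipschitz {R : realType} (a b : R) P g : primitive_on a b P g ->
  exists2 M, 0 <= M & forall x y, a <= x -> x <= y -> y <= b -> `|P y - P x| <= M * (y - x).
Proof.
move=> [hg HP]; have [mg [M gM]] := hg.
have M0 : 0 <= `|M| by [].
exists `|M| => // x y ax xy yb; rewrite HP//; apply: norm_Int_le => //.
  exact: bddmeas_sub hg.
by move=> z zxy; apply: le_trans (gM _ _) (ler_norm _); lra.
Qed.

Lemma lipschitz_within {R : realType} (a b M : R) (P : R -> R) : 0 <= M ->
  (forall x y, a <= x -> x <= y -> y <= b -> `|P y - P x| <= M * (y - x)) ->
  {within `[a, b], continuous P}.
Proof.
move=> M0 H; have Lip : {in `[a, b] &, forall x y, `|P y - P x| <= M * `|y - x|}.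
  move=> x y; rewrite !in_itv/= => /andP[ax xb] /andP[ay yb].
  have [xy|yx] := leP x y.
    by rewrite (ger0_norm (_ : 0 <= y - x)) ?subr_ge0//; exact: H.
  have yx' := ltW yx.
  rewrite distrC (distrC y) (ger0_norm (_ : 0 <= x - y)) ?subr_ge0//.
  exact: H.
apply/subspace_continuousP => x /= xab.
apply/cvgrPdist_le => /= e e0; near=> y.
rewrite distrC; have yab : y \in `[a, b]%R by near: y; exact: near_withinT.
apply: le_trans (Lip _ _ xab yab) _.
have : `|x - y| < e / (M + 1).
  near: y; apply: cvgr_dist_lt; last by rewrite divr_gt0//; lra.
  exact: cvg_within.
rewrite distrC => yx; apply: le_trans (_ : (M + 1) * `|y - x| <= _).
  by rewrite ler_wpM2r//; lra.
by rewrite mulrC -ler_pdivlMr; [exact: ltW|lra].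
Unshelve. all: by end_near. Qed.

Lemma primitive_on_continuous {R : realType} (a b : R) P g : primitive_on a b P g ->
  {within `[a, b], continuous P}.
Proof. by move=> /primitive_on_lipschitz [M M0 H]; exact: lipschitz_within H. Qed.

Lemma primitive_on_bddmeas {R : realType} (a b : R) P g : primitive_on a b P g -> bddmeas a b P.
Proof. by move=> /primitive_on_continuous/bddmeas_within. Qed.

Lemma primitive_on_sub {R : realType} (a b c d : R) P g : a <= c -> d <= b -> primitive_on a b P g -> primitive_on c d P g.
Proof.
move=> ac db [hg HP]; split; first exact: bddmeas_sub hg.
by move=> x y cx xy yd; apply: HP => //; lra.
Qed.

Lemma primitive_on_eq {R : realType} (a b : R) P g P' g' : primitive_on a b P g ->
  (forall x, a <= x <= b -> P x = P' x) ->
  (forall x, a <= x <= b -> g x = g' x) -> measurable_fun `[a, b] g' -> primitive_on a b P' g'.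
Proof.
move=> [[mg [M gM]] HP] PP gg mg'; split.
  by split=> //; exists M => x xab; rewrite -gg// gM.
move=> x y ax xy yb; rewrite -!PP; [|lra|lra]; rewrite HP//.
by apply: eq_Int => z zxy; apply: gg; lra.
Qed.

Lemma primitive_on_cst {R : realType} (a b c : R) : primitive_on a b (fun=> c) (fun=> 0).
Proof.
split; first exact: bddmeas_cst.
by move=> x y ax xy yb; rewrite Int_cst// mul0r subrr.
Qed.

Lemma primitive_onD {R : realType} (a b : R) P g Q h : primitive_on a b P g -> primitive_on a b Q h ->
  primitive_on a b (fun x => P x + Q x) (fun x => g x + h x).
Proof.
move=> [hg HP] [hh HQ]; split; first exact: bddmeasD.
move=> x y ax xy yb; rewrite IntD; [|exact: bddmeas_sub hg|exact: bddmeas_sub hh].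
by rewrite -HP// -HQ//; lra.
Qed.

Lemma primitive_onZ {R : realType} (a b c : R) P g : primitive_on a b P g ->
  primitive_on a b (fun x => c * P x) (fun x => c * g x).
Proof.
move=> [hg HP]; split; first by apply: bddmeasM => //; exact: bddmeas_cst.
move=> x y ax xy yb; rewrite IntZ; last exact: bddmeas_sub hg.
by rewrite -HP//; lra.
Qed.

(* The increments of P Q - \int (g Q + P h) are quadratically small. *)
Lemma primitive_onM {R : realType} (a b : R) P g Q h : primitive_on a b P g -> primitive_on a b Q h ->
  primitive_on a b (fun x => P x * Q x) (fun x => g x * Q x + P x * h x).
Proof.
move=> dP dQ; have [hg HP] := dP; have [hh HQ] := dQ.
have bP := primitive_on_bddmeas dP; have bQ := primitive_on_bddmeas dQ.
have bgQ : bddmeas a b (fun x => g x * Q x + P x * h x) by apply: bddmeasD; exact: bddmeasM.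
split=> // x y ax xy yb.
have [M M0 LP] := primitive_on_lipschitz dP; have [N N0 LQ] := primitive_on_lipschitz dQ.
have [[_ [G gG]] [_ [K hK]]] := (hg, hh).
have G0 : 0 <= G by apply: le_trans (gG x _); [exact: normr_ge0|lra].
have K0 : 0 <= K by apply: le_trans (hK x _); [exact: normr_ge0|lra].
pose H z := P z * Q z - Int x z (fun x => g x * Q x + P x * h x).
suff : H x = H y.
  rewrite /H set_itv1 Rintegral_set1; lra.
(* [M] and [N] are Lipschitz constants of [P] and [Q]; [G] and [K] bound [g] and [h]. *)
apply: (@quadratic_increments_cst R x y (M * N + (G * N + M * K))) => // s t xs st ty.
have as_ : a <= s by lra. have tb : t <= b by lra.
have sub f : bddmeas a b f -> bddmeas s t f by exact: bddmeas_sub.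
rewrite /H (@Int_split R x s t) //; last by apply: bddmeas_sub bgQ; lra.
(* Freezing [P] and [Q] at [s] reproduces the first-order increments exactly; what remains carries a
   factor of size t - s inside an integral of length t - s. *)
have -> : Int s t (fun x => g x * Q x + P x * h x) =
   Q s * (P t - P s) + P s * (Q t - Q s) +
   Int s t (fun x => g x * (Q x - Q s) + (P x - P s) * h x).
  rewrite HP// HQ// -!IntZ; [|exact: sub|exact: sub].
  rewrite -!IntD; [by apply: eq_Int => z _; ring| | | |];
  repeat first [exact: sub|exact: bddmeas_cst|apply: bddmeasD|apply: bddmeasB|apply: bddmeasM].
set J := Int s t (fun x => g x * (Q x - Q s) + (P x - P s) * h x).
set J0 := Int x s (fun x => g x * Q x + P x * h x).
have -> : P t * Q t - (J0 + (Q s * (P t - P s) + P s * (Q t - Q s) + J)) -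
    (P s * Q s - J0) = (P t - P s) * (Q t - Q s) - J by ring.
apply: le_trans (ler_normB _ _) _; rewrite [leRHS]mulrDl; apply: lerD.
  rewrite normrM expr2 mulrACA; apply: ler_pM => //; [exact: LP|exact: LQ].
rewrite expr2 mulrA; apply: norm_Int_le => //.
  repeat first [exact: sub|exact: bddmeas_cst|apply: bddmeasD|apply: bddmeasB|apply: bddmeasM].
move=> z /andP[sz zt].
have ts : z - s <= t - s by lra.
apply: le_trans (ler_normD _ _) _; rewrite !normrM mulrDl; apply: lerD.
  rewrite -mulrA; apply: ler_pM => //; first by apply: gG; lra.
  by apply: le_trans (LQ _ _ as_ sz _) _; [lra|rewrite ler_wpM2l].
rewrite mulrAC; apply: ler_pM => //; last by apply: hK; lra.
by apply: le_trans (LP _ _ as_ sz _) _; [lra|rewrite ler_wpM2l].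
Qed.

Lemma primitive_on_int0 {R : realType} (a b : R) P g : a <= b -> primitive_on a b P g -> P a = P b -> Int a b g = 0.
Proof. by move=> ab [_ HP] Pab; rewrite -HP// Pab subrr. Qed.

(** * Wirtinger's inequality *)

Lemma primitive_on_C1 {R : realType} (a b : R) (F f : R -> R) :
  (forall x : R, a <= x <= b -> is_derive x 1 F (f x)) ->
  {within `[a, b], continuous f} -> primitive_on a b F f.
Proof.
move=> dF cf; split; first exact: bddmeas_within.
move=> x y ax; rewrite le_eqVlt => /predU1P[<- _|xy yb].
  by rewrite set_itv1 Rintegral_set1 subrr.
have cF z : a <= z <= b -> {for z, continuous F}.
  move=> /dF [dz _]; apply: differentiable_continuous; exact/derivable1_diffP.
have -> // : Int x y f = F y - F x.
rewrite /Rintegral (@continuous_FTC2 R f F)//.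
- by apply: continuous_subspaceW cf; apply: subset_itv; rewrite bnd_simp//; lra.
- split.
  + move=> z; rewrite in_itv /= => zxy; apply: (@ex_derive _ _ _ _ _ _ _ (dF _ _)); lra.
  + by apply: cvg_at_right_filter; apply: cF; lra.
  + by apply: cvg_at_left_filter; apply: cF; lra.
- move=> z; rewrite in_itv /= => zxy; rewrite derive1E.
  by apply: (@derive_val _ _ _ _ _ _ _ (dF _ _)); lra.
Qed.

Lemma primitive_on_C1T {R : realType} (a b : R) (F f : R -> R) :
  (forall x : R, is_derive x 1 F (f x)) -> continuous f -> primitive_on a b F f.
Proof.
by move=> dF cf; apply: primitive_on_C1; exact: continuous_subspaceT.
Qed.

(* Expanding the square (g + T u)^2 with T = k tan(k(x-c)), which solves T' = k^2 + T^2. *)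
Lemma wirtinger_piece {R : realType} (a b c k : R) u g : a <= b ->
  (forall x, a <= x <= b -> - (pi / 2) < k * (x - c) < pi / 2) ->
  primitive_on a b u g ->
  k ^+ 2 * Int a b (fun x => u x ^+ 2) <= Int a b (fun x => g x ^+ 2) +
    (k * tan (k * (b - c)) * u b ^+ 2 - k * tan (k * (a - c)) * u a ^+ 2).
Proof.
move=> ab kc du.
pose T x := k * tan (k * (x - c)).
have cos0 x : a <= x <= b -> cos (k * (x - c)) != 0.
  by move=> /kc xab; apply: lt0r_neq0; exact: cos_gt0_pihalf.
have dT x : a <= x <= b -> is_derive x 1 T (k ^+ 2 + T x ^+ 2).
  move=> /cos0 c0; have ? := is_derive_tan c0.
  apply: is_derive_eq; rewrite /T /tan /GRing.scale/=.
  move: (cos2Dsin2 (k * (x - c))) c0.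
  set C := cos _; set S := sin _ => CS C0.
  rewrite subr0 !mulr1.
  by rewrite -[LHS]mulr1 -CS; field.
have cT : {within `[a, b], continuous T}.
  apply: derivable_within_continuous => x; rewrite in_itv => xab.
  by have [] := dT x xab.
have dTT : primitive_on a b T (fun x => k ^+ 2 + T x ^+ 2).
  apply: primitive_on_C1 => //.
  apply: derivable_within_continuous => x; rewrite in_itv => xab.
  by have ? := dT x xab; exact: ex_derive.
have dH := primitive_onM dTT (primitive_onM du du).
have bu := primitive_on_bddmeas du; have [bg _] := du; have bT := primitive_on_bddmeas dTT.
have [bH HH] := dH.
have /= := HH _ _ (lexx a) ab (lexx b).
rewrite /T -!expr2 => ->.
rewrite -IntZ; last exact: bddmeasX.
rewrite -IntD//; last exact: bddmeasX.
apply: le_Int.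
- by apply: bddmeasM; [exact: bddmeas_cst|exact: bddmeasX].
- by apply: bddmeasD => //; exact: bddmeasX.
move=> x _; rewrite -subr_ge0 [leRHS](_ : _ = (g x + T x * u x) ^+ 2) ?sqr_ge0//.
rewrite /T; ring.
Qed.

(** After subtraction of a constant, [u] vanishes at two points half a period apart. On each half
    period the tangent comparison applies, because k L / 2 < pi keeps the tangent finite up to the
    ends; this is why [k] stays strictly below 2 pi / L. *)
Lemma wirtinger {R : realType} (L k : R) u g : 0 < L -> 0 < k -> k * L < 2 * pi ->
  primitive_on 0 L u g -> u 0 = u L -> Int 0 L u = 0 ->
  k ^+ 2 * Int 0 L (fun x => u x ^+ 2) <= Int 0 L (fun x => g x ^+ 2).
Proof.
move=> L0 k0 kL du uL Iu.
have [M M0 lipu] := primitive_on_lipschitz du.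
(* The function c |-> u (c + L / 2) - u c takes opposite values at 0 and L / 2, since u 0 = u L. *)
have [x0 /[!in_itv]/= x0L ux0] : exists2 c, c \in `[0, L / 2] & u (c + L / 2) - u c = 0.
  apply: IVT; first by lra.
    apply: (@lipschitz_within _ _ _ (M + M)) => [|x y x0 xy yL]; first by lra.
    rewrite mulrDl [X in `|X|](_ : _ = (u (y + L / 2) - u (x + L / 2)) - (u y - u x)); last by ring.
    apply: le_trans (ler_normB _ _) _; apply: lerD; last by apply: lipu; lra.
    apply: le_trans (lipu _ _ _ _ _) _; [lra|lra|lra|].
    by rewrite ler_wpM2l//; lra.
  rewrite add0r -splitr uL ge_min le_max; lra.
pose w x := u x - u x0.
have dw : primitive_on 0 L w g.
  have /primitive_on_eq := primitive_onD du (primitive_on_cst 0 L (- u x0)); apply=> //.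
    by move=> x _ /=; rewrite addr0.
  by have [[]] := du.
have bu := primitive_on_bddmeas du; have bw := primitive_on_bddmeas dw; have [bg _] := du.
have step : k ^+ 2 * Int 0 L (fun x => w x ^+ 2) <= Int 0 L (fun x => g x ^+ 2).
  have [x00 x0h] := andP x0L.
  have x01 : x0 <= x0 + L / 2 by lra.
  have x10 : 0 <= x0 + L / 2 by lra.
  have x1L : x0 + L / 2 <= L by lra.
  have x0L' : x0 <= L by lra.
  have split3 f : bddmeas 0 L f -> Int 0 L f = Int 0 x0 f + Int x0 (x0 + L / 2) f + Int (x0 + L / 2) L f.
    move=> bf; rewrite (@Int_split _ _ (x0 + L / 2) _ f); [|by []..].
    by rewrite (@Int_split _ _ x0 _ f); [|by []..|exact: bddmeas_sub bf].
  rewrite (split3 (fun x => w x ^+ 2)) ?(split3 (fun x => g x ^+ 2)); [|exact: bddmeasX..].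
  have wx0 : w x0 = 0 by rewrite /w subrr.
  have wx1 : w (x0 + L / 2) = 0 by rewrite /w ux0.
  have wL : w 0 = w L by rewrite /w uL.
  have kh : k * (L / 4) < pi / 2 by lra.
  have kc x c : - (L / 4) <= x - c <= L / 4 -> - (pi / 2) < k * (x - c) < pi / 2 by nra.
  have R1 x : 0 <= x <= x0 -> - (pi / 2) < k * (x - (x0 - L / 4)) < pi / 2 by move=> ?; apply: kc; lra.
  have R2 x : x0 <= x <= x0 + L / 2 -> - (pi / 2) < k * (x - (x0 + L / 4)) < pi / 2 by move=> ?; apply: kc; lra.
  have R3 x : x0 + L / 2 <= x <= L -> - (pi / 2) < k * (x - (x0 + 3 * L / 4)) < pi / 2 by move=> ?; apply: kc; lra.
  have := @wirtinger_piece _ 0 x0 (x0 - L / 4) k w g.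
  have := @wirtinger_piece _ x0 (x0 + L / 2) (x0 + L / 4) k w g.
  have := @wirtinger_piece _ (x0 + L / 2) L (x0 + 3 * L / 4) k w g.
  rewrite wx0 wx1 wL.
  (* The second half period wraps around the end of [[0, L]]. Its two pieces have centres differing
     by L, so their boundary terms at 0 and at L cancel. *)
  rewrite (_ : L - (x0 + 3 * L / 4) = 0 - (x0 - L / 4)); last by field.
  move=> W3 W2 W1.
  have {}W1 := W1 x00 R1 (primitive_on_sub (lexx 0) x0L' dw).
  have {}W2 := W2 x01 R2 (primitive_on_sub x00 x1L dw).
  have {}W3 := W3 x1L R3 (primitive_on_sub x10 (lexx L) dw).
  rewrite expr0n /= !mulr0 in W1 W2 W3.
  rewrite !mulrDr; apply: le_trans (lerD (lerD W1 W2) W3) _.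
  by rewrite le_eqVlt; apply/orP; left; apply/eqP; ring.
apply: le_trans step; rewrite ler_wpM2l ?sqr_ge0//.
(* As [u] has zero mean, shifting it by a constant only increases its square integral. *)
have -> : Int 0 L (fun x => w x ^+ 2) = Int 0 L (fun x => u x ^+ 2) + u x0 ^+ 2 * L.
  rewrite (@eq_Int _ _ _ _ (fun x => u x ^+ 2 + ((- 2 * u x0) * u x + u x0 ^+ 2))); last first.
    by move=> x _; rewrite /w; ring.
  rewrite !IntD ?IntZ// ?Iu ?Int_cst; [by ring|by lra|..];
  repeat first [exact: bu|exact: bddmeas_cst|apply: bddmeasX|apply: bddmeasD|apply: bddmeasM].
by rewrite lerDl mulr_ge0 ?sqr_ge0// ltW.
Qed.

(** * The Riccati equation *)

Lemma derive1_periodic {R : realType} (L : R) (f : R -> R) : Defs.periodic L f -> Defs.periodic L (derive1 f).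
Proof.
move=> pf x; rewrite /derive1.
by under eq_fun do rewrite addrA !pf.
Qed.

Lemma periodic0 {R : realType} (L : R) (f : R -> R) : Defs.periodic L f -> f 0 = f L.
Proof. by move=> pf; rewrite -[in RHS](add0r L) pf. Qed.

Lemma derivable_continuous {R : realType} (f : R -> R) :
  (forall x, derivable f x 1) -> continuous f.
Proof.
move=> df x; apply: differentiable_continuous; exact/derivable1_diffP.
Qed.

Lemma riccati_of_eigen {R : realType} (L lambda k : R) (b c : R -> R) : 0 < L ->
  is_principal_eigenvalue L lambda b k ->
  bddmeas 0 L c -> {ae @lebesgue_measure R, forall x, b x = c x} ->
  exists p psi, [/\ primitive_on 0 L p (fun x => - k - lambda ^+ 2 - c x - 2 * lambda * p x - p x ^+ 2),
    p 0 = p L, Int 0 L p = 0, primitive_on 0 L psi (fun x => p x * psi x) & forall x, 0 < psi x].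
Proof.
move=> L0 [psi [psiL psi0 [psi2 [dpsi lpsi2 Hpsi2] Heq]]] bc bc_ae.
have cpsi := derivable_continuous dpsi.
set phi := derive1 psi in Hpsi2 Heq.
have dpsi' (x : R) : is_derive x 1 psi (phi x).
  by rewrite /phi derive1E; exact: derivableP.
have ipsi2 : lebesgue_measure.-integrable `[0, L] (EFin \o psi2).
  have [mpsi2 _ fin] := lpsi2; apply/integrableP; split.
    by apply/measurable_EFinP; exact: measurable_funTS.
  by apply: fin => //; exact: segment_compact.
(* Being a primitive of an integrable function, psi' is continuous, hence bounded on the period. *)
have cphi : {within `[0, L], continuous phi}.
  have /(_ _) cint := parameterized_integral_continuous (ltW L0) ipsi2.
  apply: (@subspace_eq_continuous _ _ _ (fun x => phi 0 + parameterized_integral lebesgue_measure 0 x psi2)).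
    move=> x; rewrite inE /= in_itv /= => /andP[x0 _].
    by rewrite /parameterized_integral -Hpsi2// addrC subrK.
  by move=> x; apply: cvgD; [exact: cvg_cst|exact: cint].
have bphi := bddmeas_within cphi; have bpsi : bddmeas 0 L psi by exact: bddmeas_cont.
(* The equation itself supplies this bounded representative of psi'', whereas [psi2] is only known
   to be locally integrable. *)
pose h x := - (2 * lambda) * phi x - (c x + (lambda ^+ 2 + k)) * psi x.
have bh : bddmeas 0 L h.
  by repeat first [exact: bphi|exact: bpsi|exact: bc|exact: bddmeas_cst|apply: bddmeasB|apply: bddmeasM|apply: bddmeasD].
have dphi : primitive_on 0 L phi h.
  split=> // x y x0 xy yL; rewrite Hpsi2// /Rintegral; congr fine.
  have sub : `[x, y] `<=` `[0, L] by apply: subset_itv; rewrite bnd_simp.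
  apply: ae_eq_integral => //.
  - apply/measurable_EFinP; apply: measurable_funTS.
    by case: lpsi2.
  - apply/measurable_EFinP; apply: measurable_funS sub _ => //; by case: bh.
  - have F := ae_filter_ringOfSetsType (@lebesgue_measure R).
    move: Heq bc_ae; apply: (@filterS2 _ _ F) => z e1 e2 _.
    by congr EFin; rewrite /h -e2; lra.
have dV : primitive_on 0 L (fun x => (psi x)^-1) (fun x => - ((psi x)^-1 * (psi x)^-1) * phi x).
  have cV : {within `[0, L], continuous (fun x => (psi x)^-1)}.
    apply: continuous_subspaceT => x; apply: cvgV; last exact: cpsi.
    exact: lt0r_neq0.
  apply: primitive_on_C1 => [x _|].
    apply: is_derive_eq; first by apply: is_deriveV; exact: lt0r_neq0.
    by rewrite /GRing.scale/= -exprVn expr2.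
  move=> x; apply: cvgM; last exact: cphi.
  by apply: cvgN; apply: cvgM; exact: cV.
pose p x := phi x * (psi x)^-1.
have dp : primitive_on 0 L p (fun x => - k - lambda ^+ 2 - c x - 2 * lambda * p x - p x ^+ 2).
  have hp := primitive_onM dphi dV; have bp := primitive_on_bddmeas hp.
  apply: (primitive_on_eq hp) => //.
    move=> x _; rewrite /h /p; field; exact: lt0r_neq0.
  suff [] : bddmeas 0 L (fun x => - k - lambda ^+ 2 - c x - 2 * lambda * p x - p x ^+ 2) by [].
  by repeat first [exact: bp|exact: bc|exact: bddmeas_cst|apply: bddmeasB|apply: bddmeasX|apply: bddmeasM|apply: bddmeasD].
exists p, psi; split => //.
  by rewrite /p (periodic0 psiL) /phi (periodic0 (derive1_periodic psiL)).
  (* p is the derivative of the periodic function ln psi. *)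
  apply: (@primitive_on_int0 _ _ _ (fun x => ln (psi x))); [exact: ltW| |by rewrite (periodic0 psiL)].
  apply: primitive_on_C1; last exact: primitive_on_continuous dp.
  move=> x _; have ? := is_derive1_ln (psi0 x).
  by apply: is_derive_eq; rewrite /GRing.scale/= mulrC.
apply: primitive_on_C1.
  by move=> x _; apply: is_derive_eq; rewrite /p mulfVK// lt0r_neq0.
by move=> x; apply: cvgM; [exact: (primitive_on_continuous dp)|exact: continuous_subspaceT].
Qed.

Definition riccati_rhs {R : realType} (lambda m : R) (v p : R -> R) (x : R) : R :=
  m - v x - 2 * lambda * p x - p x ^+ 2.

Definition riccati {R : realType} (L lambda m : R) (v p : R -> R) : Prop :=
  [/\ 0 < L, bddmeas 0 L v, primitive_on 0 L p (riccati_rhs lambda m v p), p 0 = p L & Int 0 L p = 0].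

Lemma riccati_mean {R : realType} (L lambda m : R) v p : riccati L lambda m v p ->
  m * L = Int 0 L v + Int 0 L (fun x => p x ^+ 2).
Proof.
move=> [L0 bv dp pL Ip]; have bp := primitive_on_bddmeas dp.
have := primitive_on_int0 (ltW L0) dp pL; rewrite /riccati_rhs.
rewrite !IntB; [|by bddmeas_tac..]; rewrite Int_cst ?(ltW L0)// IntZ// Ip; lra.
Qed.

(** p' p and p' p^2 are the derivatives of p^2 / 2 and p^3 / 3, which are periodic. *)
Lemma riccati_orth {R : realType} (L lambda m : R) v p : riccati L lambda m v p ->
  Int 0 L (fun x => riccati_rhs lambda m v p x * p x) = 0 /\
  Int 0 L (fun x => riccati_rhs lambda m v p x * p x ^+ 2) = 0.
Proof.
move=> [L0 bv dp pL Ip]; have bp := primitive_on_bddmeas dp; have [bg _] := dp.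
have d2 := primitive_onM dp dp; have d3 := primitive_onM dp d2.
have := primitive_on_int0 (ltW L0) d2; have := primitive_on_int0 (ltW L0) d3.
rewrite /= pL => /(_ erefl) h3 /(_ erefl) h2; split.
  suff : 2 * Int 0 L (fun x => riccati_rhs lambda m v p x * p x) = 0 by lra.
  by rewrite -IntZ; [rewrite -[RHS]h2; apply: eq_Int => x _; ring|by bddmeas_tac].
suff : 3 * Int 0 L (fun x => riccati_rhs lambda m v p x * p x ^+ 2) = 0 by lra.
by rewrite -IntZ; [rewrite -[RHS]h3; apply: eq_Int => x _; ring|by bddmeas_tac].
Qed.

(** In the equation multiplied by p', every term except - v p' integrates to zero, so the integral
    of p'^2 equals that of - v p'. Neither [lambda] nor [m] enters the bound. *)
Lemma riccati_grad {R : realType} (L lambda m : R) v p : riccati L lambda m v p ->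
  Int 0 L (fun x => riccati_rhs lambda m v p x ^+ 2) <= Int 0 L (fun x => v x ^+ 2).
Proof.
move=> ric_p; have [ ort1 ort2] := riccati_orth ric_p.
have [L0 bv dp pL Ip] := ric_p; have bp := primitive_on_bddmeas dp; have [bg _] := dp.
have o0 := primitive_on_int0 (ltW L0) dp pL.
set g := riccati_rhs _ _ _ _ in o0 ort1 ort2 bg *.
have h : Int 0 L (fun x => g x ^+ 2) = - Int 0 L (fun x => g x * v x).
  rewrite (@eq_Int _ _ _ _ (fun x => m * g x - g x * v x - (2 * lambda) * (g x * p x) - g x * p x ^+ 2)).
    rewrite !IntB; [|by bddmeas_tac..]; rewrite !IntZ; [|by bddmeas_tac..]; rewrite o0 ort1 ort2; ring.
  by move=> x _; rewrite expr2 {2}/g /riccati_rhs; ring.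
have : Int 0 L (fun x => (- 2) * (g x * v x)) <= Int 0 L (fun x => g x ^+ 2 + v x ^+ 2).
  apply: le_Int; [by bddmeas_tac|by bddmeas_tac|].
  move=> x _; have := sqr_ge0 (g x + v x); rewrite sqrrD; lra.
rewrite IntZ; last by bddmeas_tac.
rewrite IntD; [|by bddmeas_tac..]; lra.
Qed.

Lemma riccati_sup {R : realType} (L lambda m eta : R) v p : riccati L lambda m v p ->
  0 < eta -> (forall x, 0 <= x <= L -> `|v x| <= eta) ->
  forall x, 0 <= x <= L -> `|p x| <= eta * L.
Proof.
move=> ric_p e0 ve x /andP[x0 xL]; have hg := riccati_grad ric_p.
have [L0 bv dp pL Ip] := ric_p; have bp := primitive_on_bddmeas dp; have [bg Hp] := dp.
set g := riccati_rhs _ _ _ _ in Hp bg hg *.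
have bng := bddmeas_norm bg.
have Gle : Int 0 L (fun x => `|g x|) <= eta * L.
  (* Young's inequality in place of Cauchy-Schwarz; with the weight [eta] both terms contribute at
     most eta L / 2. *)
  have h : Int 0 L (fun x => `|g x|) <= Int 0 L (fun x => eta / 2 + (2 * eta)^-1 * g x ^+ 2).
    apply: le_Int => //; first by bddmeas_tac.
    move=> z _; rewrite -subr_ge0 -(real_normK (num_real (g z))).
    rewrite [leRHS](_ : _ = (2 * eta)^-1 * (`|g z| - eta) ^+ 2).
      by rewrite mulr_ge0 ?sqr_ge0// invr_ge0; lra.
    by field; lra.
  apply: le_trans h _; rewrite IntD; [|by bddmeas_tac..].
  rewrite Int_cst ?(ltW L0)// IntZ; last by bddmeas_tac.
  have : Int 0 L (fun x => v x ^+ 2) <= Int 0 L (fun=> eta ^+ 2).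
    apply: le_Int; [by bddmeas_tac|by bddmeas_tac|].
    by move=> z zL; rewrite -(real_normK (num_real (v z))) lerXn2r ?nnegrE ?ve// ltW.
  rewrite Int_cst ?(ltW L0)// => hv.
  have : (2 * eta)^-1 * Int 0 L (fun x => g x ^+ 2) <= (2 * eta)^-1 * (eta ^+ 2 * (L - 0)).
    by rewrite ler_wpM2l ?invr_ge0; lra.
  have -> : (2 * eta)^-1 * (eta ^+ 2 * (L - 0)) = eta / 2 * L by field; lra.
  lra.
have lip s t : 0 <= s -> s <= t -> t <= L -> `|p t - p s| <= eta * L.
  move=> s0 st tL; rewrite Hp//; apply: le_trans Gle.
  have bst : bddmeas s t g by apply: bddmeas_sub bg.
  apply: le_trans (le_normr_Rintegral _ (bddmeas_integrable bst)) _ => //.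
  rewrite (@Int_split _ 0 t L)//; [|lra].
  rewrite (@Int_split _ 0 s t)//; [|by apply: bddmeas_sub bng].
  have : 0 <= Int 0 s (fun x => `|g x|) by apply: Rintegral_ge0.
  have : 0 <= Int t L (fun x => `|g x|) by apply: Rintegral_ge0.
  lra.
(* By the zero mean of [p] this integral is L p(x), so [p] is bounded by its oscillation. *)
have : `|Int 0 L (fun y => p x - p y)| <= eta * L * (L - 0).
  apply: norm_Int_le; [lra|by bddmeas_tac|].
  move=> y /andP[y0 yL]; have [xy|/ltW yx] := leP x y.
    by rewrite distrC; exact: lip.
  exact: lip.
rewrite IntB; [|by bddmeas_tac..]; rewrite Int_cst ?(ltW L0)// Ip !subr0 normrM (gtr0_norm L0).
by rewrite ler_pM2r.
Qed.

(** Square p' + 2 lambda p = m - (v + p^2) and integrate. On the left the cross term vanishes and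
    Wirtinger bounds p' from below; on the right [m] is the mean of v + p^2, so centring only
    decreases the square integral. The smallness of [p] absorbs the terms beyond v^2. *)
Lemma riccati_upper {R : realType} (L lambda m e k : R) v p : riccati L lambda m v p ->
  0 < k -> k * L < 2 * pi -> 0 <= e -> (forall x, 0 <= x <= L -> `|p x| <= e) ->
  (k ^+ 2 + 4 * lambda ^+ 2 - e - e ^+ 2) * Int 0 L (fun x => p x ^+ 2) <=
    (1 + e) * Int 0 L (fun x => v x ^+ 2).
Proof.
move=> ric_p k0 kL e0 pe; have [ ort1 _] := riccati_orth ric_p.
have mE := riccati_mean ric_p.
have [L0 bv dp pL Ip] := ric_p; have bp := primitive_on_bddmeas dp; have [bg _] := dp.
have W := wirtinger L0 k0 kL dp pL Ip.
set g := riccati_rhs _ _ _ _ in bg ort1 W *.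
have h1 : Int 0 L (fun x => (g x + 2 * lambda * p x) ^+ 2) =
    Int 0 L (fun x => g x ^+ 2) + 4 * lambda ^+ 2 * Int 0 L (fun x => p x ^+ 2).
  rewrite (@eq_Int _ _ _ _ (fun x => g x ^+ 2 + (4 * lambda) * (g x * p x) + (4 * lambda ^+ 2) * p x ^+ 2)).
    rewrite !IntD; [|by bddmeas_tac..]; rewrite !IntZ; [|by bddmeas_tac..]; rewrite ort1; ring.
  by move=> x _; ring.
have h2 : Int 0 L (fun x => (g x + 2 * lambda * p x) ^+ 2) =
    Int 0 L (fun x => (v x + p x ^+ 2) ^+ 2) - m ^+ 2 * L.
  rewrite (@eq_Int _ _ _ _ (fun x => m ^+ 2 - (2 * m) * (v x + p x ^+ 2) + (v x + p x ^+ 2) ^+ 2)).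
    rewrite IntD; [|by bddmeas_tac..]; rewrite IntB; [|by bddmeas_tac..]; rewrite IntZ; [|by bddmeas_tac].
    rewrite Int_cst ?(ltW L0)// [Int _ _ (fun x => v x + p x ^+ 2)]IntD; [|by bddmeas_tac..].
    rewrite -mE; ring.
  by move=> x _; rewrite /g /riccati_rhs; ring.
have h3 : Int 0 L (fun x => (v x + p x ^+ 2) ^+ 2) <=
    Int 0 L (fun x => (1 + e) * v x ^+ 2 + (e + e ^+ 2) * p x ^+ 2).
  apply: le_Int; [by bddmeas_tac|by bddmeas_tac|].
  move=> x xL; have /ler_normlP [p1 p2] := pe x xL.
  have pp : p x ^+ 2 <= e ^+ 2 by nra.
  have h4 : p x ^+ 2 * p x ^+ 2 <= e ^+ 2 * p x ^+ 2 by rewrite ler_wpM2r// sqr_ge0.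
  have h5 : 2 * (v x * p x) * p x <= e * (v x ^+ 2 + p x ^+ 2).
    have q1 : 0 <= v x ^+ 2 - 2 * (v x * p x) + p x ^+ 2.
      by rewrite [leRHS](_ : _ = (v x - p x) ^+ 2) ?sqr_ge0//; ring.
    have q2 : 0 <= v x ^+ 2 + 2 * (v x * p x) + p x ^+ 2.
      by rewrite [leRHS](_ : _ = (v x + p x) ^+ 2) ?sqr_ge0//; ring.
    set V2 := v x ^+ 2 in q1 q2 *; set P2 := p x ^+ 2 in q1 q2 *; set vp := v x * p x in q1 q2 *.
    have : `|2 * vp| <= V2 + P2 by rewrite ler_norml; apply/andP; split; lra.
    move=> q; apply: le_trans (ler_norm _) _; rewrite normrM mulrC.
    by apply: ler_pM => //; exact: pe.
  nra.
rewrite IntD in h3; [|by bddmeas_tac..]; rewrite !IntZ in h3; [|by bddmeas_tac..].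
have : 0 <= m ^+ 2 * L by rewrite mulr_ge0 ?sqr_ge0// ltW.
lra.
Qed.

(* Testing the equation with p + V, where V is the primitive of the oscillating part of v. *)
Lemma riccati_oscillation {R : realType} (L lambda m t : R) v v0 V p :
  riccati L lambda m v p -> (forall x, 0 <= x <= L -> v x = v0 x + t) ->
  primitive_on 0 L V v0 -> V 0 = V L -> Int 0 L V = 0 -> 0 < lambda ->
  (forall x, 0 <= x <= L -> `|p x| <= lambda) ->
  Int 0 L (fun x => p x ^+ 2) <= 3 * Int 0 L (fun x => V x ^+ 2).
Proof.
move=> [L0 bv dp pL Ip] vE dV VL IV l0 ple; have bp := primitive_on_bddmeas dp; have [bg _] := dp.
have bV := primitive_on_bddmeas dV; have [bv0 _] := dV.
have dr := primitive_onD dp dV; have drr := primitive_onM dr dr.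
have := primitive_on_int0 (ltW L0) drr; rewrite /= pL VL => /(_ erefl) h.
have h1 : Int 0 L (fun x => (2 * lambda + p x) * p x * (p x + V x)) = 0.
  suff : 2 * Int 0 L (fun x => (2 * lambda + p x) * p x * (p x + V x)) = 0 by lra.
  rewrite -(addr0 (2 * _)) -[X in _ + X]h -IntZ; last by bddmeas_tac.
  rewrite -IntD; [|by bddmeas_tac..].
  rewrite (@eq_Int _ _ _ _ (fun x => (2 * (m - t)) * (p x + V x))).
    by rewrite IntZ; [rewrite IntD// Ip IV; ring|by bddmeas_tac].
  by move=> x xL; rewrite /riccati_rhs vE//; ring.
(* Since |p| <= lambda, the weight (2 lambda + p) / 2 lies between lambda / 2 and 3 lambda / 2; it
   multiplies p^2 - V^2 + (p + V)^2, the double of p (p + V). *)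
have h2 : Int 0 L (fun x => (lambda / 2) * p x ^+ 2 - (3 * lambda / 2) * V x ^+ 2) <=
    Int 0 L (fun x => (2 * lambda + p x) * p x * (p x + V x)).
  apply: le_Int; [by bddmeas_tac|by bddmeas_tac|].
  move=> x xL; have /ler_normlP [p1 p2] := ple x xL.
  have := sqr_ge0 (p x + V x); have := sqr_ge0 (p x); have := sqr_ge0 (V x).
  have -> : (2 * lambda + p x) * p x * (p x + V x) = (2 * lambda + p x) / 2 * (p x ^+ 2 - V x ^+ 2 + (p x + V x) ^+ 2) by field.
  nra.
rewrite h1 IntB in h2; [|by bddmeas_tac..]; rewrite !IntZ in h2; [|by bddmeas_tac..].
nra.
Qed.

(* Expansion of the square of p - tau (-w' + 2 lambda w). *)
Lemma riccati_lower {R : realType} (L lambda m e tau : R) v p w w' :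
  riccati L lambda m v p -> primitive_on 0 L w w' -> w 0 = w L -> Int 0 L w = 0 -> 0 <= tau ->
  (forall x, 0 <= x <= L -> w x <= e) ->
  - 2 * tau * Int 0 L (fun x => v x * w x)
    - tau ^+ 2 * Int 0 L (fun x => (2 * lambda * w x - w' x) ^+ 2) <=
  (1 + 2 * tau * e) * Int 0 L (fun x => p x ^+ 2).
Proof.
move=> [L0 bv dp pL Ip] dw wL Iw t0 we; have bp := primitive_on_bddmeas dp; have [bg _] := dp.
have bw := primitive_on_bddmeas dw; have [bw' _] := dw.
have dpw := primitive_onM dp dw.
have := primitive_on_int0 (ltW L0) dpw; rewrite /= pL wL => /(_ erefl) h.
pose Z x := 2 * lambda * w x - w' x.
have h1 : 0 <= Int 0 L (fun x => (p x - tau * Z x) ^+ 2).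
  by apply: Rintegral_ge0 => x _; exact: sqr_ge0.
(* In the cross term p Z, the equation trades 2 lambda p w for p' w and terms in m w, v w and p^2 w.
   The combination p' w + p w' is exact and [w] has zero mean, so only v w and p^2 w survive. *)
have bZ : bddmeas 0 L Z by rewrite /Z; bddmeas_tac.
rewrite (@eq_Int _ _ _ _ (fun x => p x ^+ 2 + (2 * tau) * (riccati_rhs lambda m v p x * w x + p x * w' x)
  + (- 2 * tau * m) * w x + (2 * tau) * (v x * w x) + (2 * tau) * (p x ^+ 2 * w x) + tau ^+ 2 * Z x ^+ 2)) in h1; last first.
  by move=> x _; rewrite /riccati_rhs /Z; ring.
rewrite !IntD in h1; [|by bddmeas_tac..]; rewrite !IntZ in h1; [|by bddmeas_tac..].
rewrite h Iw in h1.
have : Int 0 L (fun x => p x ^+ 2 * w x) <= Int 0 L (fun x => e * p x ^+ 2).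
  by apply: le_Int; [bddmeas_tac|bddmeas_tac|move=> x xL; rewrite mulrC ler_wpM2r ?sqr_ge0// we].
rewrite IntZ; [|by bddmeas_tac] => /(ler_wpM2l t0).
move: h1; rewrite /Z; lra.
Qed.

Lemma within_continuous_gt0 {R : realType} (a b : R) (E : R -> R) : a <= b ->
  {within `[a, b], continuous E} -> (forall x, 0 < E x) ->
  exists2 c, 0 < c & forall x, a <= x <= b -> c <= E x.
Proof.
move=> ab cE E0; have [c cab Hc] := EVT_min ab cE.
by exists (E c) => // x xab; apply: Hc; rewrite in_itv.
Qed.

(** [E] is an integrating factor: (d E)' = s E > 0, so d E increases strictly. If d 0 >= 0, then [d]
    is positive after 0; if d L < 0, then [d] is negative throughout. As d 0 = d L, one of these
    cases occurs and the mean cannot vanish. *)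
Lemma no_forced_periodic {R : realType} (L s0 : R) (d s a E : R -> R) : 0 < L ->
  bddmeas 0 L s -> (forall x, 0 <= x <= L -> s0 <= s x) -> 0 < s0 ->
  primitive_on 0 L d (fun x => s x - a x * d x) -> primitive_on 0 L E (fun x => a x * E x) -> (forall x, 0 < E x) ->
  d 0 = d L -> Int 0 L d <> 0.
Proof.
move=> L0 bs ss s00 dd dE E0 dL; have bd := primitive_on_bddmeas dd; have bE := primitive_on_bddmeas dE.
have [_ HD] := primitive_onM dd dE.
have [c c0 cE] := within_continuous_gt0 (ltW L0) (primitive_on_continuous dE) E0.
have [_ [M EM]] := bE.
have M0 : 0 < M by apply: lt_le_trans (EM 0 _); [rewrite normr_gt0 lt0r_neq0|lra].
have {}EM x : 0 <= x <= L -> E x <= M by move=> /EM; apply: le_trans; exact: ler_norm.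
have c'0 : 0 < s0 * c by rewrite mulr_gt0.
have inc x y : 0 <= x -> x <= y -> y <= L -> s0 * c * (y - x) <= d y * E y - d x * E x.
  move=> x0 xy yL; rewrite HD// -Int_cst//.
  have sub f : bddmeas 0 L f -> bddmeas x y f by exact: bddmeas_sub.
  rewrite [leRHS](@eq_Int _ _ _ _ (fun x => s x * E x)); last by move=> z _; ring.
  apply: le_Int; [exact: bddmeas_cst|by apply: bddmeasM; exact: sub|].
  move=> z zxy; apply: ler_pM; [lra|lra|apply: ss; lra|apply: cE; lra].
have [d0|d0] := leP 0 (d 0).
  (* A linear lower bound for [d], whose integral is strictly positive. *)
  have : Int 0 L (fun x => s0 * c / M * x) <= Int 0 L d.
    apply: le_Int => //; first by apply: bddmeasM; [exact: bddmeas_cst|apply: bddmeas_cont => x; exact: cvg_id].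
    move=> x /andP[x0 xL]; rewrite mulrAC ler_pdivrMr//.
    have dE0 : 0 <= d 0 * E 0 by rewrite mulr_ge0// ltW.
    have h := inc 0 x (lexx 0) x0 xL.
    have dx : 0 <= d x.
      rewrite -(pmulr_lge0 _ (E0 x)); nra.
    have : d x * E x <= d x * M by rewrite ler_wpM2l// EM// x0.
    lra.
  have dsq : primitive_on 0 L (fun x : R => s0 * c / M / 2 * x ^+ 2) (fun x => s0 * c / M * x).
    apply: primitive_on_C1T => [x|x].
      by apply: is_derive_eq; rewrite /GRing.scale/= ; field; lra.
    by apply: cvgM; [exact: cvg_cst|exact: cvg_id].
  have := dsq.2 0 L (lexx _) (ltW L0) (lexx _); rewrite /= => <- h h0.
  rewrite h0 expr0n /= mulr0 subr0 in h.
  have : 0 < s0 * c / M / 2 * L ^+ 2 by rewrite mulr_gt0 ?divr_gt0 ?exprn_gt0.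
  lra.
have DL : d L * E L < 0 by rewrite -dL nmulr_rlt0.
have : Int 0 L d <= Int 0 L (fun=> d L * E L / M).
  apply: le_Int => //; first exact: bddmeas_cst.
  move=> x /andP[x0 xL]; rewrite ler_pdivlMr//.
  have h := inc x L x0 xL (lexx L).
  have h1 : 0 <= s0 * c * (L - x) by rewrite mulr_ge0 ?subr_ge0// ltW.
  have dx : d x < 0.
    rewrite -(pmulr_llt0 _ (E0 x)); lra.
  have : d x * M <= d x * E x by rewrite ler_wnM2l ?(ltW dx)// EM// x0.
  lra.
rewrite Int_cst ?(ltW L0)// => h h0.
have : d L * E L / M * (L - 0) < 0 by rewrite subr0 pmulr_llt0// pmulr_llt0// invr_gt0.
lra.
Qed.

(** * Existence of principal eigenvalues *)

(** The oriented integral from 0 to x: for x of either sign, one of the two segments is empty or a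
    point. *)
Definition prim {R : realType} (g : R -> R) (x : R) : R := Int 0 x g - Int x 0 g.

Lemma prim0 {R : realType} (g : R -> R) : prim g 0 = 0.
Proof. by rewrite /prim subrr. Qed.

Lemma is_derive_prim {R : realType} (g : R -> R) (x : R) : continuous g -> is_derive x 1 (prim g) (g x).
Proof.
(* The base point is moved to the left of both 0 and x, so that near x a single formula holds
   whatever the sign. *)
move=> cg; pose a := - (`|x| + 1); pose u := `|x| + 1.
have /andP[xa xu] : a < x < u.
  have := ler_norm x; have := ler_norm (- x); rewrite normrN /a /u => *; apply/andP; split; lra.
have a0 : a < 0 by rewrite /a; have := normr_ge0 x; lra.
have u0 : 0 < u by rewrite /u; have := normr_ge0 x; lra.
have bg s t : bddmeas s t g by exact: bddmeas_cont.
have pE y : a < y -> prim g y = Int a y g - Int a 0 g.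
  move=> ay; rewrite /prim; have [y0|/ltW y0] := leP 0 y.
    rewrite (@Int_split _ a 0 y)//; [|exact: ltW].
    have -> : Int y 0 g = 0.
      move: y0; rewrite le_eqVlt => /predU1P[<-|y0]; first by rewrite set_itv1 Rintegral_set1.
      by rewrite set_itv_ge ?Rintegral_set0// bnd_simp -ltNge.
    lra.
  rewrite (@Int_split _ a y 0)//; [|exact: ltW].
  have -> : Int 0 y g = 0.
    move: y0; rewrite le_eqVlt => /predU1P[->|y0]; first by rewrite set_itv1 Rintegral_set1.
    by rewrite set_itv_ge ?Rintegral_set0// bnd_simp -ltNge.
  lra.
have [dF FE] := continuous_FTC1_closed xu (bddmeas_integrable (bg a u)) xa (cg x).
have dF' : is_derive x 1 (fun y => Int a y g - Int a 0 g) (g x).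
  apply: is_derive_eq; last exact: subr0.
  by apply: is_deriveB; rewrite -FE derive1E; exact: derivableP.
apply: near_eq_is_derive dF'.
by near=> y; rewrite pE//; near: y; exact: lt_nbhsr.
Unshelve. all: by end_near. Qed.

Lemma mean_value_bound {R : realType} (F f : R -> R) (M x y : R) : x <= y ->
  (forall z : R, is_derive z 1 F (f z)) -> (forall z, x <= z <= y -> `|f z| <= M) ->
  `|F y - F x| <= M * (y - x).
Proof.
move=> xy dF fM.
have cF : {within `[x, y], continuous F}.
  by apply: derivable_within_continuous => z _; exact: ex_derive.
have [c cxy ->] := MVT_segment xy (fun z _ => dF z) cF.
rewrite normrM (ger0_norm (_ : 0 <= y - x)) ?subr_ge0// ler_wpM2r ?subr_ge0//.
by apply: fM; move: cxy; rewrite in_itv.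
Qed.

Lemma periodic_primitive {R : realType} (L : R) (F f : R -> R) :
  (forall z : R, is_derive z 1 F (f z)) -> Defs.periodic L f -> F L = F 0 -> Defs.periodic L F.
Proof.
move=> dF pf FL x.
have dD (z : R) : is_derive z 1 (fun z => F (z + L) - F z) 0.
  have ? := dF (z + L); have ? := dF z.
  apply: is_derive_eq; rewrite /GRing.scale/= pf; ring.
have := is_derive_0_is_cst x 0 dD; rewrite add0r FL; lra.
Qed.

(* Zero mean, expressed by the existence of a periodic primitive. *)
Definition zero_mean {R : realType} (L : R) (g : R -> R) : Prop :=
  [/\ continuous g, Defs.periodic L g &
    exists G, (forall z : R, is_derive z 1 G (g z)) /\ Defs.periodic L G].

Definition mean {R : realType} (L : R) (h : R -> R) : R := prim h L / L.

Lemma zero_mean_center {R : realType} (L : R) (h : R -> R) : 0 < L -> continuous h -> Defs.periodic L h ->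
  zero_mean L (fun x => mean L h - h x).
Proof.
move=> L0 ch ph.
have ph' : Defs.periodic L (fun x => mean L h - h x) by move=> x; rewrite ph.
split=> //.
  by move=> x; apply: cvgB; [exact: cvg_cst|exact: ch].
have dG (z : R) : is_derive z 1 (fun x => mean L h * x - prim h x) (mean L h - h z).
  have ? := is_derive_prim z ch.
  by apply: is_derive_eq; rewrite /GRing.scale/=; ring.
exists (fun x => mean L h * x - prim h x); split => //.
apply: (periodic_primitive dG ph').
by rewrite prim0 /mean; field; rewrite lt0r_neq0.
Qed.

Lemma mean_dist {R : realType} (L M : R) (g h : R -> R) : 0 < L -> continuous g -> continuous h ->
  (forall x, `|g x - h x| <= M) -> `|mean L g - mean L h| <= M.
Proof.
move=> L0 cg ch gh.
have dG (z : R) : is_derive z 1 (fun x => prim g x - prim h x) (g z - h z).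
  by apply: is_deriveB; exact: is_derive_prim.
have := mean_value_bound (ltW L0) dG (fun z _ => gh z).
rewrite !prim0 !subr0 /mean -mulrBl normrM normfV (gtr0_norm L0).
by rewrite ler_pdivrMr.
Qed.

(** * The linear periodic equation q' + 2 lambda q = g and its integrating factor *)

Definition exp2 {R : realType} (lambda x : R) := expR (2 * lambda * x).

Lemma is_derive_exp2 {R : realType} (lambda x : R) : is_derive x 1 (exp2 lambda) (2 * lambda * exp2 lambda x).
Proof. by apply: is_derive_eq; rewrite /GRing.scale/= /exp2; ring. Qed.

Lemma exp2_gt1 {R : realType} (lambda L : R) : 0 < L -> 0 < lambda -> 1 < exp2 lambda L.
Proof. by move=> *; rewrite /exp2 expR_gt1 !mulr_gt0. Qed.

(* q is bounded by M / (2 lambda), as (q - M / (2 lambda)) exp(2 lambda x) is monotone. *)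
Lemma linear_one_sided {R : realType} (L lambda : R) (q g : R -> R) M : 0 < L -> 0 < lambda ->
  (forall x : R, is_derive x 1 q (g x - 2 * lambda * q x)) ->
  Defs.periodic L q -> (forall x, g x <= M) -> forall x, 2 * lambda * q x <= M.
Proof.
move=> L0 l0 dq pq gM x; have exL := exp2_gt1 L0 l0.
pose F y := (2 * lambda * q y - M) * exp2 lambda y.
have dF (y : R) : is_derive y 1 F (2 * lambda * (g y - M) * exp2 lambda y).
  have ? := is_derive_exp2 lambda y; apply: is_derive_eq; rewrite /GRing.scale/=; ring.
have xL : x <= x + L by rewrite lerDl ltW.
have cF : {within `[x, x + L], continuous F}.
  by apply: derivable_within_continuous => z _; exact: ex_derive.
have [c _] := MVT_segment xL (fun z _ => dF z) cF.
rewrite /F pq => h.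
have exE : exp2 lambda (x + L) = exp2 lambda x * exp2 lambda L by rewrite /exp2 mulrDr expRD.
have e1 : 0 < exp2 lambda x by exact: expR_gt0.
have e2 : 0 < exp2 lambda c by exact: expR_gt0.
(* By periodicity of [q], the increment of [F] over one period is F x times exp(2 lambda L) - 1 > 0;
   the mean value theorem makes it nonpositive. *)
have : (2 * lambda * q x - M) * exp2 lambda x * (exp2 lambda L - 1) <= 0.
  have -> : (2 * lambda * q x - M) * exp2 lambda x * (exp2 lambda L - 1) = 2 * lambda * (g c - M) * exp2 lambda c * (x + L - x).
    by rewrite -h exE; ring.
  have := gM c; rewrite -subr_le0 => gc.
  have -> : 2 * lambda * (g c - M) * exp2 lambda c * (x + L - x) = - (2 * lambda * (M - g c) * exp2 lambda c * L) by ring.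
  rewrite oppr_le0; apply: mulr_ge0; last exact: ltW.
  apply: mulr_ge0; last exact: ltW.
  by apply: mulr_ge0; lra.
by rewrite pmulr_lle0 ?subr_gt0// pmulr_lle0// subr_le0.
Qed.

(** The bound M / (2 lambda) on |q| degenerates as lambda tends to 0, but it controls 2 lambda q and
    hence q' by 2 M uniformly. The zero mean then gives a zero of [q] in each period, from which |q|
    <= 2 L M. *)
Lemma linear_bound {R : realType} (L lambda : R) (q g Q : R -> R) M : 0 < L -> 0 < lambda ->
  (forall x : R, is_derive x 1 q (g x - 2 * lambda * q x)) ->
  Defs.periodic L q -> (forall x : R, is_derive x 1 Q (q x)) -> Defs.periodic L Q ->
  (forall x, `|g x| <= M) ->
  (forall x, `|g x - 2 * lambda * q x| <= 2 * M) /\ (forall x, `|q x| <= 2 * L * M).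
Proof.
move=> L0 l0 dq pq dQ pQ gM.
have u x : 2 * lambda * q x <= M.
  by apply: (linear_one_sided L0 l0 dq pq) => y; apply: le_trans (gM y); exact: ler_norm.
have l x : 2 * lambda * - q x <= M.
  apply: (@linear_one_sided _ L lambda (fun x => - q x) (fun x => - g x)) => // [y|y|y].
  - by have ? := dq y; apply: is_derive_eq; ring.
  - by rewrite pq.
  - by apply: le_trans (gM y); rewrite -normrN; exact: ler_norm.
have d x : `|g x - 2 * lambda * q x| <= 2 * M.
  have /ler_normlP[g1 g2] := gM x; have := u x; have := l x.
  by move=> *; rewrite ler_norml; apply/andP; split; lra.
split=> // x.
have xL : x < x + L by rewrite ltrDl.
have cQ : {within `[x, x + L], continuous Q}.
  by apply: derivable_within_continuous => z _; exact: ex_derive.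
(* Rolle's theorem for the periodic primitive [Q] yields the zero of [q]. *)
have [c] := MVT xL (fun z _ => dQ z) cQ.
rewrite in_itv /= => /andP[xc cL]; rewrite pQ subrr (_ : x + L - x = L); last by ring.
move=> /esym/eqP; rewrite mulf_eq0 (gt_eqF L0) orbF => /eqP qc.
have := mean_value_bound (ltW xc) dq (fun z _ => d z).
rewrite qc sub0r normrN => h; apply: le_trans h _.
have M0 : 0 <= M by apply: le_trans (gM 0).
nra.
Qed.

(** Variation of constants; the quotient is the initial value for which the solution returns to
    itself after one period. *)
Definition linear_sol {R : realType} (L lambda : R) (g : R -> R) (x : R) : R :=
  expR (- (2 * lambda * x)) * (prim (fun s => exp2 lambda s * g s) L / (exp2 lambda L - 1) + prim (fun s => exp2 lambda s * g s) x).

Lemma linear_solP {R : realType} (L lambda : R) (g : R -> R) : 0 < L -> 0 < lambda -> zero_mean L g ->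
  (forall x : R, is_derive x 1 (linear_sol L lambda g) (g x - 2 * lambda * linear_sol L lambda g x)) /\ zero_mean L (linear_sol L lambda g).
Proof.
move=> L0 l0 [cg pg [G [dG pG]]]; have exL := exp2_gt1 L0 l0.
have ceg : continuous (fun s => exp2 lambda s * g s).
  move=> x; apply: cvgM; last exact: cg.
  by apply: differentiable_continuous; apply/derivable1_diffP; have [] := is_derive_exp2 lambda x.
have dS (x : R) : is_derive x 1 (linear_sol L lambda g) (g x - 2 * lambda * linear_sol L lambda g x).
  have ? := is_derive_prim x ceg.
  apply: is_derive_eq; rewrite /GRing.scale/= /linear_sol expRN -/(exp2 lambda x).
  have := lt0r_neq0 (expR_gt0 (2 * lambda * x)); rewrite -/(exp2 lambda x) => e0.
  by set C := _ / _; field.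
have cS : continuous (linear_sol L lambda g).
  by move=> x; apply: differentiable_continuous; apply/derivable1_diffP; exact: ex_derive.
have pS : Defs.periodic L (linear_sol L lambda g).
  (* The difference of the solution and its translate solves the homogeneous equation and vanishes
     at 0. *)
  have dD (x : R) : is_derive x 1 (fun x => exp2 lambda x * (linear_sol L lambda g (x + L) - linear_sol L lambda g x)) 0.
    have ? := is_derive_exp2 lambda x; have ? := dS x.
    have dSL : is_derive x 1 (fun x => linear_sol L lambda g (x + L)) (g (x + L) - 2 * lambda * linear_sol L lambda g (x + L)).
      by have ? := dS (x + L); apply: is_derive_eq; rewrite /GRing.scale/=; ring.
    by apply: is_derive_eq; rewrite /GRing.scale/= pg; ring.
  move=> x; have := is_derive_0_is_cst x 0 dD.
  have -> : exp2 lambda 0 * (linear_sol L lambda g (0 + L) - linear_sol L lambda g 0) = 0.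
    rewrite add0r /linear_sol prim0 mulr0 oppr0 expR0 expRN -/(exp2 lambda L).
    by field; rewrite !lt0r_neq0// ?subr_gt0 ?expR_gt0//.
  move/eqP; rewrite mulf_eq0 gt_eqF ?expR_gt0//= subr_eq0 => /eqP//.
split=> //; split=> //.
(* A periodic primitive is read off the equation: 2 lambda q = g - q'. *)
exists (fun x => (G x - linear_sol L lambda g x) / (2 * lambda)); split.
  move=> z; have ? := dG z; have ? := dS z.
  by apply: is_derive_eq; rewrite /GRing.scale/=; field; lra.
by move=> x; rewrite pG pS.
Qed.

Lemma linear_sol_dist {R : realType} (L lambda : R) (g h : R -> R) M : 0 < L -> 0 < lambda -> zero_mean L g -> zero_mean L h -> (forall x, `|g x - h x| <= M) ->
  forall x, `|linear_sol L lambda g x - linear_sol L lambda h x| <= 2 * L * M.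
Proof.
move=> L0 l0 zg zh ghM.
have [dSg [_ pSg [G [dG pG]]]] := linear_solP L0 l0 zg; have [dSh [_ pSh [H [dH pH]]]] := linear_solP L0 l0 zh.
have [] := @linear_bound _ L lambda (fun x => linear_sol L lambda g x - linear_sol L lambda h x) (fun x => g x - h x) (fun x => G x - H x) M => //.
- by move=> x; have ? := dSg x; have ? := dSh x; apply: is_derive_eq; ring.
- by move=> x; rewrite pSg pSh.
- by move=> x; rewrite pG pH.
Qed.

(** * A fixed point for the Riccati equation *)

Lemma is_derive_continuous {R : realType} (f df : R -> R) : (forall x : R, is_derive x 1 f (df x)) -> continuous f.
Proof. by move=> dfx; apply: derivable_continuous => x; exact: ex_derive. Qed.

Lemma lipschitz_continuous {R : realType} (M : R) (f : R -> R) : 0 <= M ->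
  (forall x y, x <= y -> `|f y - f x| <= M * (y - x)) -> continuous f.
Proof.
move=> M0 H x.
have := @lipschitz_within R (x - 1) (x + 1) M f M0 (fun s t _ st _ => H s t st).
move=> /(continuous_within_itvP _ _) h.
have [h1 _ _] := h ltac:(lra).
by apply: h1; rewrite in_itv /=; apply/andP; split; lra.
Qed.

Lemma le0_geometric {R : realType} (x C : R) : (forall n, x <= C * 2^-1 ^+ n) -> x <= 0.
Proof.
move=> H; rewrite leNgt; apply/negP => x0.
have C0 : 0 < C by have := H 0%N; rewrite expr0 mulr1; lra.
have [n Hn] : exists n : nat, C / x < n%:R.
  exists (Num.bound `|C / x|).
  by apply: le_lt_trans (ler_norm _) _; exact: archi_boundP.
have n2 : n%:R <= 2 ^+ n :> R by rewrite -natrX ler_nat ltnW// ltn_expl.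
have := H n; rewrite exprVn ler_pdivlMr ?exprn_gt0// => h.
rewrite ltr_pdivrMr// in Hn.
have : n%:R * x <= 2 ^+ n * x by rewrite ler_wpM2r// ltW.
lra.
Qed.

(** The limit is the supremum of the increasing sequence u_n - 2 C 2^-n; the decreasing sequence u_n
    + 2 C 2^-n bounds it from above, and the rate is immediate. *)
Lemma geometric_limit {R : realType} (u : nat -> R -> R) (C : R) :
  (forall n x, `|u n.+1 x - u n x| <= C * 2^-1 ^+ n) ->
  exists v, forall n x, `|v x - u n x| <= 2 * C * 2^-1 ^+ n.
Proof.
move=> H.
pose b x n := u n x - 2 * C * 2^-1 ^+ n.
pose a x n := u n x + 2 * C * 2^-1 ^+ n.
have C0 : 0 <= C by have := le_trans (normr_ge0 _) (H 0%N 0); rewrite expr0 mulr1.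
have half n : (2^-1 ^+ n.+1 : R) = 2^-1 ^+ n / 2 by rewrite exprSr.
have b1 x n : b x n <= b x n.+1.
  by have /ler_normlP[h1 h2] := H n x; rewrite /b half; lra.
have a1 x n : a x n.+1 <= a x n.
  by have /ler_normlP[h1 h2] := H n x; rewrite /a half; lra.
have bm_ x n k : b x n <= b x (n + k)%N.
  by elim: k => [|k IH]; rewrite ?addn0// addnS; apply: le_trans IH _.
have am_ x n k : a x (n + k)%N <= a x n.
  by elim: k => [|k IH]; rewrite ?addn0// addnS; apply: le_trans IH.
have ba x n k : b x n <= a x k.
  apply: le_trans (bm_ x n k) _; rewrite addnC; apply: le_trans (am_ x k n).
  by rewrite /a /b; have : 0 <= 2 * C * 2^-1 ^+ (k + n) :> R; [rewrite !mulr_ge0// exprn_ge0|lra].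
exists (fun x => sup (range (b x))) => n x.
have ub : has_ubound (range (b x)) by exists (a x 0%N) => _ [k _ <-]; exact: ba.
have h1 : b x n <= sup (range (b x)) by apply: ub_le_sup => //; exists n.
have h2 : sup (range (b x)) <= a x n.
  by apply: ge_sup; [exists (b x 0%N); exists 0%N|move=> _ [k _ <-]; exact: ba].
rewrite ler_norml; apply/andP; split; move: h1 h2; rewrite /b /a; lra.
Qed.

(* Banach fixed point for p |-> linear_sol (mean (v + p^2) - v - p^2) on a ball of radius
   1/(16 L), which is independent of lambda. *)
Lemma riccati_exists {R : realType} (L lambda eta : R) (v : R -> R) : 0 < L -> 0 < lambda ->
  continuous v -> Defs.periodic L v -> (forall x, `|v x| <= eta) -> eta <= (100 * L ^+ 2)^-1 ->
  exists (m : R) (p : R -> R), (forall x : R, is_derive x 1 p (m - v x - p x ^+ 2 - 2 * lambda * p x)) /\ zero_mean L p.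
Proof.
move=> L0 l0 cv pv ve eL.
(* The map p |-> mean - (v + p^2) has Lipschitz constant 4 rho and the linear solver 2 L, so 8 L rho
   = 1 / 2 is the contraction factor. *)
pose rho := (16 * L)^-1.
have rho0 : 0 < rho by rewrite invr_gt0 mulr_gt0.
have Lrho : L * rho = 1 / 16 by rewrite /rho; field; lra.
pose h p x := v x + p x ^+ 2.
pose N p x := mean L (h p) - h p x.
have ch p : continuous p -> continuous (h p).
  by move=> cp x; apply: cvgD; [exact: cv|apply: cvgM; exact: cp].
have ph p : Defs.periodic L p -> Defs.periodic L (h p) by move=> pp x; rewrite /h pv pp.
have NP p : zero_mean L p -> zero_mean L (N p) by move=> [cp pp _]; apply: zero_mean_center => //; [exact: ch|exact: ph].
have Ndist p q M : continuous p -> continuous q -> (forall x, `|p x| <= rho) -> (forall x, `|q x| <= rho) ->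
    (forall x, `|p x - q x| <= M) -> forall x, `|N p x - N q x| <= 4 * rho * M.
  move=> cp cq bp bq pq x.
  have hpq y : `|h p y - h q y| <= 2 * rho * M.
    have -> : h p y - h q y = (p y + q y) * (p y - q y) by rewrite /h; ring.
    rewrite normrM; apply: ler_pM => //.
    by apply: le_trans (ler_normD _ _) _; have := bp y; have := bq y; lra.
  have := mean_dist L0 (ch _ cp) (ch _ cq) hpq.
  have := hpq x; rewrite /N => /ler_normlP[h1 h2] /ler_normlP[h3 h4].
  by rewrite ler_norml; apply/andP; split; lra.
have Nbound p : continuous p -> (forall x, `|p x| <= rho) -> forall x, `|N p x| <= 2 * (eta + rho ^+ 2).
  move=> cp bp x.
  have hb y : `|h p y - (fun=> 0) y| <= eta + rho ^+ 2.
    rewrite subr0; apply: le_trans (ler_normD _ _) _; apply: lerD => //.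
    by rewrite normrX lerXn2r ?nnegrE// ltW.
  have c0 : continuous (fun _ : R => (0 : R)) by move=> y; exact: cvg_cst.
  have := mean_dist L0 (ch _ cp) c0 hb.
  have -> : mean L (fun=> 0) = 0 :> R.
    by rewrite /mean /prim !Rintegral_cst// !mul0r subrr mul0r.
  have := hb x; rewrite /N !subr0 => /ler_normlP[h1 h2] /ler_normlP[h3 h4].
  by rewrite ler_norml; apply/andP; split; lra.
(* The ball is preserved: the [eta] term costs at most 64 / 100 of [rho] and the quadratic term a
   quarter; this fixes the threshold on [eta]. *)
have bal : 2 * L * (2 * (eta + rho ^+ 2)) <= rho.
  have e1 : L * eta <= L * (100 * L ^+ 2)^-1 by rewrite ler_wpM2l// ltW.
  have e2 : L * (100 * L ^+ 2)^-1 = 16 / 100 * rho by rewrite /rho; field; lra.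
  have e3 : L * rho ^+ 2 = rho / 16 by rewrite expr2 mulrA Lrho; ring.
  lra.
pose S := linear_sol L lambda.
have Sball p : zero_mean L p -> (forall x, `|p x| <= rho) -> forall x, `|S (N p) x| <= rho.
  move=> zp bp x; have [cp _ _] := zp; apply: le_trans bal.
  have [dS [_ pS [Q [dQ pQ]]]] := linear_solP L0 l0 (NP _ zp).
  have [_ ] := linear_bound L0 l0 dS pS dQ pQ (Nbound _ cp bp).
  exact.
have SLip p : zero_mean L p -> (forall x, `|p x| <= rho) -> forall x y, x <= y ->
   `|S (N p) y - S (N p) x| <= 2 * (2 * (eta + rho ^+ 2)) * (y - x).
  move=> zp bp x y xy; have [cp _ _] := zp.
  have [dS [_ pS [Q [dQ pQ]]]] := linear_solP L0 l0 (NP _ zp).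
  have [H _] := linear_bound L0 l0 dS pS dQ pQ (Nbound _ cp bp).
  by apply: (mean_value_bound xy dS) => z _; exact: H.
pose u n := iter n (fun p => S (N p)) (fun _ : R => (0 : R)).
have z0 : zero_mean L (fun _ : R => (0 : R)).
  split; [by move=> x; exact: cvg_cst|by []|].
  by exists (fun=> 0); split=> // z; exact: is_derive_cst.
have uP n : zero_mean L (u n) /\ forall x, `|u n x| <= rho.
  elim: n => [|n [zn bn]]; first by split => // x; rewrite normr0 ltW.
  split; last exact: Sball.
  by have [] := linear_solP L0 l0 (NP _ zn).
have Sdist p q M : zero_mean L p -> zero_mean L q -> (forall x, `|p x| <= rho) -> (forall x, `|q x| <= rho) ->
    (forall x, `|p x - q x| <= M) -> forall x, `|S (N p) x - S (N q) x| <= M / 2.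
  move=> zp zq bp bq pq x; have [cp _ _] := zp; have [cq _ _] := zq.
  apply: le_trans (linear_sol_dist L0 l0 (NP _ zp) (NP _ zq) (Ndist _ _ _ cp cq bp bq pq) x) _.
  have -> : 2 * L * (4 * rho * M) = 8 * (L * rho) * M by ring.
  by rewrite Lrho; lra.
have uC n x : `|u n.+1 x - u n x| <= rho * 2^-1 ^+ n.
  elim: n x => [|n IH] x.
    by rewrite expr0 mulr1 /= subr0; exact: (uP 1%N).2.
  have [zn bn] := uP n; have [zn1 bn1] := uP n.+1.
  by rewrite exprSr mulrA; exact: (Sdist _ _ _ zn1 zn bn1 bn IH).
have [p up] := geometric_limit uC.
have bp x : `|p x| <= rho.
  rewrite -subr_le0; apply: (@le0_geometric _ _ (2 * rho)) => n.
  have := up n x; have := (uP n).2 x.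
  have := ler_normD (p x - u n x) (u n x); rewrite subrK; lra.
have K0 : 0 <= 2 * (2 * (eta + rho ^+ 2)).
  have : 0 <= eta by apply: le_trans (ve 0).
  have := sqr_ge0 rho; lra.
(* All iterates after the start share one Lipschitz constant, which passes to the limit. *)
have cp : continuous p.
  apply: (lipschitz_continuous K0) => x y xy.
  rewrite -subr_le0; apply: (@le0_geometric _ _ (4 * rho)) => n.
  have [zn bn] := uP n.
  have := SLip _ zn bn x y xy; rewrite -/(u n.+1).
  have := up n.+1 x; have := up n.+1 y; rewrite exprSr.
  have -> : p y - p x = (p y - u n.+1 y) + (u n.+1 y - u n.+1 x) - (p x - u n.+1 x) by ring.
  set A := p y - _; set B := u n.+1 y - _; set D := p x - _ => h1 h2 h3.
  have := ler_normB (A + B) D; have := ler_normD A B.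
  have : 0 <= rho * 2^-1 ^+ n by rewrite mulr_ge0 ?exprn_ge0// ltW.
  move: h3; rewrite /B /=; lra.
have pp : Defs.periodic L p.
  move=> x; apply/eqP; rewrite -subr_eq0 -normr_eq0 eq_le normr_ge0 andbT.
  apply: (@le0_geometric _ _ (4 * rho)) => n.
  have [[_ pn _] _] := uP n.
  have := up n (x + L); have := up n x; rewrite pn.
  have -> : p (x + L) - p x = (p (x + L) - u n x) - (p x - u n x) by ring.
  by have := ler_normB (p (x + L) - u n x) (p x - u n x); lra.
(* Continuity and periodicity of [p] suffice to centre the nonlinearity; the zero mean and
   differentiability of [p] follow only from the fixed point identity. *)
have zNp : zero_mean L (N p) by apply: zero_mean_center => //; [exact: ch|exact: ph].
have pE : p = S (N p).
  apply/funext => x; apply/eqP; rewrite -subr_eq0 -normr_eq0 eq_le normr_ge0 andbT.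
  apply: (@le0_geometric _ _ (2 * rho)) => n.
  have [zn bn] := uP n; have [cn _ _] := zn.
  have h1 := up n.+1 x.
  have nn y : `|N (u n) y - N p y| <= 4 * rho * (2 * rho * 2^-1 ^+ n).
    by apply: Ndist => // z; rewrite distrC; exact: up.
  have := linear_sol_dist L0 l0 (NP _ zn) zNp nn x; rewrite -/S -/(u n.+1).
  have -> : 2 * L * (4 * rho * (2 * rho * 2^-1 ^+ n)) = 8 * (L * rho) * (2 * rho * 2^-1 ^+ n) by ring.
  rewrite Lrho => h2.
  have -> : p x - S (N p) x = (p x - u n.+1 x) + (u n.+1 x - S (N p) x) by ring.
  have := ler_normD (p x - u n.+1 x) (u n.+1 x - S (N p) x).
  move: h1 h2; rewrite exprSr /=; lra.
have [dS zS] := linear_solP L0 l0 zNp.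
exists (mean L (h p)), p; split; last by rewrite pE.
move=> x; rewrite {1}pE; apply: is_derive_eq; rewrite -/S -pE /N /h; ring.
Qed.

Lemma continuous_locally_integrable {R : realType} (g : R -> R) : continuous g -> locally_integrable setT g.
Proof.
move=> cg; split; [exact: continuous_measurable_fun|exact: openT|].
move=> K _ cK.
have /integrableP[] := continuous_compact_integrable cK (continuous_subspaceT cg).
by move=> _; exact.
Qed.

Lemma principal_eigenvalue_exists {R : realType} (L lambda eta c : R) (v : R -> R) : 0 < L -> 0 < lambda ->
  continuous v -> Defs.periodic L v -> (forall x, `|v x| <= eta) -> eta <= (100 * L ^+ 2)^-1 ->
  exists k, is_principal_eigenvalue L lambda (fun x => c + v x) k.
Proof.
move=> L0 l0 cv pv ve eL.
have [m [p [dp [cp pp [P [dP pP]]]]]] := riccati_exists L0 l0 cv pv ve eL.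
(* The logarithmic derivative is inverted; the zero mean of [p] is what makes psi = exp P
   periodic. *)
exists (- (m + c + lambda ^+ 2)), (fun x => expR (P x)).
have dpsi (x : R) : is_derive x 1 (fun x => expR (P x)) (p x * expR (P x)).
  by have ? := dP x; apply: is_derive_eq; rewrite /GRing.scale/=; ring.
have Epsi : derive1 (fun x => expR (P x)) = (fun x => p x * expR (P x)).
  by apply/funext => x; rewrite derive1E; exact: derive_val.
pose psi2 x := (m - v x - 2 * lambda * p x) * expR (P x).
have dpsi2 (x : R) : is_derive x 1 (fun x => p x * expR (P x)) (psi2 x).
  have ? := dp x; have ? := dpsi x.
  by apply: is_derive_eq; rewrite /GRing.scale/= /psi2; ring.
have cE := is_derive_continuous dpsi.
have cpsi2 : continuous psi2.
  move=> x; apply: cvgM; last exact: cE.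
  apply: cvgB; first by apply: cvgB; [exact: cvg_cst|exact: cv].
  by apply: cvgM; [exact: cvg_cst|exact: cp].
split; [by move=> x; rewrite pP|by move=> x; exact: expR_gt0|].
exists psi2; first split.
- by move=> x; exact: ex_derive.
- exact: continuous_locally_integrable.
- move=> x y xy; rewrite Epsi.
  exact: (primitive_on_C1T x y dpsi2 cpsi2).2.
- by apply: aeW => x; rewrite Epsi /psi2; ring.
Qed.

(** * Taylor expansion of the constraint *)

Lemma mean_value_ball {R : realType} (F f : R -> R) (M r b x : R) : `|x - b| <= r ->
  (forall z : R, `|z - b| <= r -> is_derive z 1 F (f z)) ->
  (forall z : R, `|z - b| <= r -> `|f z| <= M) ->
  `|F x - F b| <= M * `|x - b|.
Proof.
move=> xr dF fM.
have seg u v : u <= v -> (forall z, u <= z <= v -> `|z - b| <= r) -> `|F v - F u| <= M * (v - u).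
  move=> uv H.
  have cF : {within `[u, v], continuous F}.
    apply: derivable_within_continuous => z; rewrite in_itv => zuv.
    by have ? := dF z (H z zuv); exact: ex_derive.
  have dF' z : z \in `]u, v[ -> is_derive z 1 F (f z).
    by rewrite in_itv /= => zuv; apply: dF; apply: H; lra.
  have [c cuv ->] := MVT_segment uv dF' cF.
  rewrite normrM (ger0_norm (_ : 0 <= v - u)) ?subr_ge0// ler_wpM2r ?subr_ge0//.
  by apply: fM; apply: H; move: cuv; rewrite in_itv.
have /ler_normlP[x1 x2] := xr.
have r0 : 0 <= r by apply: le_trans xr.
have [bx|/ltW xb] := leP b x.
  rewrite (ger0_norm (_ : 0 <= x - b)) ?subr_ge0//; apply: seg => // z zbx.
  by rewrite ler_norml; apply/andP; split; lra.
rewrite distrC (distrC x) (ger0_norm (_ : 0 <= b - x)) ?subr_ge0//; apply: seg => // z zbx.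
by rewrite ler_norml; apply/andP; split; lra.
Qed.

(** The mean value inequality is used twice on the ball of radius |v|: for f' minus its
    linearisation, then for the second-order remainder, whose derivative is the function just
    bounded. *)
Lemma taylor2 {R : realType} (f : R -> R) (b : R) :
  (\forall x \near b, derivable f x 1 /\ derivable (derive1 f) x 1) ->
  {for b, continuous (derive1n 2 f)} ->
  forall eps, 0 < eps -> exists2 eta, 0 < eta & forall v, `|v| <= eta ->
    `|f (b + v) - f b - derive1 f b * v - derive1n 2 f b / 2 * v ^+ 2| <= eps * v ^+ 2.
Proof.
move=> df cf eps e0.
have d2 z : derivable (derive1 f) z 1 -> is_derive z 1 (derive1 f) (derive1n 2 f z).
  by move=> dz; rewrite /= derive1E; exact: derivableP.
move: (derive1n 2 f) cf d2 => f'' cf d2.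
have : \forall x \near b, [/\ derivable f x 1, derivable (derive1 f) x 1 & `|f'' b - f'' x| <= eps].
  near=> x; have [] : derivable f x 1 /\ derivable (derive1 f) x 1 by near: x.
  by split=> //; near: x; apply: (cvgrPdist_le _ _).1.
move=> /nbhs_ballP[r /= r0 H]; exists (r / 2); first lra.
move=> v vr; pose x := b + v.
have vE : v = x - b by rewrite /x; ring.
rewrite vE in vr *; rewrite (_ : b + (x - b) = x); last by ring.
have {}H z : `|z - b| <= `|x - b| -> [/\ derivable f z 1, derivable (derive1 f) z 1 & `|f'' b - f'' z| <= eps].
  by move=> zx; apply: H; rewrite /ball /= distrC; lra.
set f1 := derive1 f b; set f2 := f'' b.
have d1 z : `|z - b| <= `|x - b| -> is_derive z 1 (fun z => derive1 f z - f2 * z) (f'' z - f2).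
  move=> /H [_ /d2 ? _].
  by apply: is_derive_eq; rewrite /GRing.scale/=; ring.
have h1 z : `|z - b| <= `|x - b| -> `|derive1 f z - f1 - f2 * (z - b)| <= eps * `|x - b|.
  move=> zx.
  have -> : derive1 f z - f1 - f2 * (z - b) = (derive1 f z - f2 * z) - (derive1 f b - f2 * b).
    by rewrite /f1; ring.
  apply: le_trans (_ : eps * `|z - b| <= _); last by rewrite ler_wpM2l// ltW.
  apply: (mean_value_ball (f := fun z => f'' z - f2) zx) => // y /H[_ _ h].
  by rewrite distrC.
pose F z := f z - f1 * (z - b) - f2 / 2 * (z - b) ^+ 2.
have dF z : `|z - b| <= `|x - b| -> is_derive z 1 F (derive1 f z - f1 - f2 * (z - b)).
  move=> /H[dz _ _]; have ? : is_derive z 1 f (derive1 f z).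
    by rewrite /= derive1E; exact: derivableP.
  by apply: is_derive_eq; rewrite /GRing.scale/=; field.
have := mean_value_ball (lexx _) dF h1.
rewrite (_ : eps * _ * _ = eps * (x - b) ^+ 2); last by rewrite -mulrA -expr2 real_normK ?num_real.
by rewrite /F subrr expr0n /= !mulr0 !subr0 (_ : f x - _ - _ - f b = f x - f b - f1 * (x - b) - f2 / 2 * (x - b) ^+ 2)//; ring.
Unshelve. all: by end_near. Qed.

Lemma inv_nonnegP {R : realType} (f : R -> R) (beta : R) :
  {in `[0, +oo[ &, {homo f : x y / x < y}} -> (f @` `]0, +oo[) beta ->
  0 < inv_nonneg f beta /\ f (inv_nonneg f beta) = beta.
Proof.
move=> finc [x]; rewrite /= in_itv /= andbT => x0 <-.
have inj : {in [set` `[(0 : R), +oo[] &, injective f}.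
  move=> u v; rewrite !inE /= => ui vi fuv.
  have [uv|vu|//] := ltgtP u v.
    by have := finc _ _ ui vi uv; rewrite fuv ltxx.
  by have := finc _ _ vi ui vu; rewrite fuv ltxx.
rewrite /inv_nonneg pinvKV//; rewrite inE /= in_itv /= andbT; exact: ltW.
Qed.

(** Monotonicity alone leaves open f'(b) = 0, but together with f''(b) > 0 that would make [b] a
    strict local minimum of [f]. Here [s] <= [b] keeps b - s in the domain where [f] increases. *)
Lemma derive1_gt0_strict {R : realType} (f : R -> R) (b : R) : 0 < b ->
  {in `[0, +oo[ &, {homo f : x y / x < y}} -> 0 < derive1n 2 f b ->
  (forall eps, 0 < eps -> exists2 eta, 0 < eta & forall v, `|v| <= eta ->
    `|f (b + v) - f b - derive1 f b * v - derive1n 2 f b / 2 * v ^+ 2| <= eps * v ^+ 2) ->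
  0 < derive1 f b.
Proof.
move=> b0 finc f20 T.
have [eta e0 He] := T (derive1n 2 f b / 4) ltac:(lra).
pose s := Num.min eta b.
have s0 : 0 < s by rewrite lt_min e0.
have se : s <= eta by rewrite ge_min lexx.
have sb : s <= b by rewrite ge_min lexx orbT.
have h1 : `|- s| <= eta by rewrite normrN gtr0_norm.
have /ler_normlP[h2 _] := He _ h1.
have h3 : f (b - s) < f b.
  by apply: finc; rewrite ?in_itv/= ?andbT; lra.
have s2 : 0 < s ^+ 2 by rewrite exprn_gt0.
have : 0 < derive1 f b * s.
  rewrite sqrrN in h2; have : 0 < derive1n 2 f b * s ^+ 2 by rewrite mulr_gt0.
  lra.
by rewrite pmulr_lgt0.
Qed.

(** * Null sets of periodic functions *)

Lemma lebesgue_measure_shift {R : realType} (c : R) (A : set R) : measurable A ->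
  lebesgue_measure ((fun x => x + c) @^-1` A) = lebesgue_measure A.
Proof.
move=> mA.
have mf : measurable_fun setT ((fun x => x + c) : _ -> measurableTypeR R).
  by apply: measurable_funD => //; exact: measurable_cst.
pose f := @mfun_Sub _ _ (measurableTypeR R) (measurableTypeR R) _ (mem_set mf).
suff : lebesgue_measure A = pushforward lebesgue_measure f A by move=> ->.
apply: lebesgue_measure_unique => // _ [[a b]] _ <-.
rewrite /pushforward /=.
rewrite [X in _ = lebesgue_measure X](_ : _ = `](a - c), (b - c)]%classic); last first.
  by apply/seteqP; split => x /=; rewrite !in_itv /= ltrBlDr lerBrDr.
rewrite !lebesgue_measure_itv/= !lte_fin ltrD2r.
by case: ifP => // _; rewrite -!EFinB; congr EFin; ring.
Qed.

Lemma periodic_int {R : realType} (L : R) (g : R -> R) (k : int) x : Defs.periodic L g ->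
  g (x + k%:~R * L) = g x.
Proof.
move=> pg; have pn (n : nat) y : g (y + n%:R * L) = g y.
  elim: n => [|n IH]; first by rewrite mul0r addr0.
  by rewrite -natr1 mulrDl mul1r addrA pg.
case: k => n; first exact: pn.
by rewrite NegzE mulrNz mulNr -(pn n.+1) subrK.
Qed.

Lemma ae_periodic {R : realType} (L c : R) (b : R -> R) : 0 < L -> Defs.periodic L b ->
  measurable_fun setT b -> lebesgue_measure (`[0, L] `&` [set x | b x != c]) = 0%E ->
  {ae @lebesgue_measure R, forall x, b x = c}.
Proof.
move=> L0 pb mb Z0; pose Z := `[0, L] `&` [set x | b x != c].
have mZ : measurable Z.
  apply: measurableI => //.
  have -> : [set x | b x != c] = b @^-1` (~` [set c]).
    by apply/seteqP; split => x /=; move/eqP.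
  rewrite -[_ @^-1` _]setTI; apply: mb => //; apply: measurableC; exact: measurable_set1.
pose T (k : R) := (fun x => x + k) @^-1` Z.
have mT k : measurable (T k).
  rewrite /T -[_ @^-1` _]setTI.
  have mf : measurable_fun setT ((fun x => x + k) : R -> R).
    by apply: measurable_funD => //; exact: measurable_cst.
  exact: mf.
have nT k : lebesgue_measure.-negligible (T k).
  by exists (T k); split; [exact: mT|exact: etrans (lebesgue_measure_shift k mZ) Z0|].
(* The exceptional set is covered by the translates of its part in one period, by multiples of L of
   both signs. *)
have nU : lebesgue_measure.-negligible (\bigcup_(n : nat) (T (n%:R * L) `|` T (- (n%:R * L)))).
  by apply: negligible_bigcup => n; apply: negligibleU.
apply: negligibleS nU => x /= /eqP bx.
pose k := Num.floor (x / L).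
have kx : k%:~R <= x / L < (k + 1)%:~R by rewrite floor_le floorD1_gt.
have {kx} : x - k%:~R * L \in `[0, L].
  move: kx => /andP[]; rewrite ler_pdivlMr// ltr_pdivrMr// rmorphD /= => k1 k2.
  by rewrite in_itv /=; apply/andP; split; lra.
have per : b (x - k%:~R * L) != c.
  by rewrite -mulNr -mulrNz periodic_int.
case: k per => n per xn.
  by exists n => //; right; split.
exists n.+1 => //; left; move: per xn; rewrite NegzE mulrNz mulNr opprK => per xn.
by split.
Qed.

Lemma Linfty_distE {R : realType} (b1 b2 : R -> R) :
  Linfty_dist b1 b2 = ess_sup lebesgue_measure (fun x => `|(b1 x - b2 x)%:E|%E).
Proof.
rewrite /Linfty_dist unlock.
(* The norm of exponent +oo unfolds to the essential supremum once the whole space has positive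
   measure. *)
have -> // : (0 < @lebesgue_measure R setT)%E.
by rewrite -set_itvNyy lebesgue_measure_itv; exact: lt0y.
Qed.

Lemma Linfty_dist_leP {R : realType} (b1 b2 : R -> R) (eta : R) :
  (Linfty_dist b1 b2 <= eta%:E)%E <-> {ae @lebesgue_measure R, forall x, `|b1 x - b2 x| <= eta}.
Proof.
have F := ae_filter_ringOfSetsType (@lebesgue_measure R).
rewrite Linfty_distE; split.
  move/ess_supP; apply: (@filterS _ _ F).
  by move=> x; rewrite /= lee_fin.
move=> h; apply/ess_supP; apply: (@filterS _ _ F) h.
by move=> x; rewrite /= lee_fin.
Qed.

Lemma Linfty_dist_eq0 {R : realType} (b1 b2 : R -> R) :
  {ae @lebesgue_measure R, forall x, b2 x = b1 x} -> Linfty_dist b1 b2 = 0%E.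
Proof.
move=> h; apply/eqP; rewrite eq_le; apply/andP; split; last exact: Lnorm_ge0.
have F := ae_filter_ringOfSetsType (@lebesgue_measure R).
apply/Linfty_dist_leP; apply: (@filterS _ _ F) h.
by move=> x ->; rewrite subrr normr0.
Qed.

Lemma int_sqr_eq0 {R : realType} (L : R) (v : R -> R) : bddmeas 0 L v -> Int 0 L (fun x => v x ^+ 2) <= 0 ->
  lebesgue_measure (`[0, L] `&` [set x | v x != 0]) = 0%E.
Proof.
move=> bv le0.
have bv2 : bddmeas 0 L (fun x => v x ^+ 2) by exact: bddmeasX.
have I0 : (\int[lebesgue_measure]_(x in `[0%R, L]) `|(v x ^+ 2)%:E| = 0)%E.
  under eq_integral do rewrite gee0_abs ?lee_fin ?sqr_ge0//.
  have fin : (\int[lebesgue_measure]_(x in `[0%R, L]) (v x ^+ 2)%:E)%E \is a fin_num.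
    by apply: integrable_fin_num => //; exact: bddmeas_integrable.
  rewrite -(fineK fin); congr EFin; apply/eqP; rewrite eq_le le0 /=.
  by apply: Rintegral_ge0 => x _; exact: sqr_ge0.
have [mv _] := bv2.
have mvE : measurable_fun `[0, L] (fun x => (v x ^+ 2)%:E) by exact/measurable_EFinP.
have [N [mN N0 sN]] := (ae_eq_integral_abs lebesgue_measure (measurable_itv `[0%R, L]) mvE).1 I0.
apply: (subset_measure0 _ mN _ N0).
  have -> : `[0, L] `&` [set x | v x != 0] = `[0, L] `&` v @^-1` (~` [set 0]).
    by apply/seteqP; split => x /= [xL /eqP].
  by apply: bv.1 => //; apply: measurableC; exact: measurable_set1.
move=> x [xL /= vx]; apply: sN => /= /(_ xL)[] /eqP.
by rewrite sqrf_eq0 (negbTE vx).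
Qed.

(** * Minimal speeds *)

Lemma eigen_riccati {R : realType} (L lambda k b0 : R) (b v : R -> R) : 0 < L ->
  is_principal_eigenvalue L lambda b k -> bddmeas 0 L v ->
  {ae @lebesgue_measure R, forall x, b x = b0 + v x} ->
  exists p psi, [/\ riccati L lambda (- k - lambda ^+ 2 - b0) v p,
    primitive_on 0 L psi (fun x => p x * psi x) & forall x, 0 < psi x].
Proof.
move=> L0 pe bv bE.
have bc : bddmeas 0 L (fun x => b0 + v x) by apply: bddmeasD => //; exact: bddmeas_cst.
have [p [psi [dp pL Ip dpsi psi0]]] := riccati_of_eigen L0 pe bc bE.
exists p, psi; split => //; split => //.
have bp := primitive_on_bddmeas dp.
apply: (primitive_on_eq dp) => //; first by move=> x _; rewrite /riccati_rhs; ring.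
suff [] : bddmeas 0 L (riccati_rhs lambda (- k - lambda ^+ 2 - b0) v p) by [].
by rewrite /riccati_rhs; bddmeas_tac.
Qed.

(** One value of lambda suffices to bound a minimum from above. If the eigenvalue or the minimum is
    missing, the default 0 is still below [C]. *)
Lemma speed_bound {R : realType} (L lambda C : R) (b : R -> R) : 0 < lambda -> 0 < C ->
  (forall k, is_principal_eigenvalue L lambda b k -> - k / lambda < C) ->
  minimal_speed L b < C.
Proof.
move=> l0 C0 H; rewrite /minimal_speed.
have [[x Sx]|/forallNP Sn] := pselect (exists x, (speeds L b `&` lbound (speeds L b)) x); last first.
  by rewrite xgetPN.
have [_ lb] := xgetPex 0 (ex_intro _ x Sx).
have inS : speeds L b (- principal_eigenvalue L lambda b / lambda).
  by exists lambda => //; rewrite /= in_itv /= l0.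
apply: le_lt_trans (lb _ inS) _; rewrite /principal_eigenvalue.
have [[k pk]|/forallNP kn] := pselect (exists k, is_principal_eigenvalue L lambda b k).
  by apply: H; exact: (xgetPex 0 (ex_intro _ k pk)).
by rewrite xgetPN// oppr0 mul0r.
Qed.

Lemma speed_attained {R : realType} (L lambda : R) (b : R -> R) : 0 < lambda ->
  (forall l, 0 < l -> - principal_eigenvalue L lambda b / lambda <= - principal_eigenvalue L l b / l) ->
  minimal_speed L b = - principal_eigenvalue L lambda b / lambda.
Proof.
move=> l0 H; rewrite /minimal_speed.
set m := - _ / _ in H *.
have Sm : (speeds L b `&` lbound (speeds L b)) m.
  split; first by exists lambda => //; rewrite /= in_itv /= l0.
  by move=> _ [l /= + <-]; rewrite in_itv /= andbT => lp; exact: H.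
have [[l /=]] := xgetI 0 Sm; rewrite in_itv /= andbT => lp lE lb.
apply/eqP; rewrite eq_le; apply/andP; split; first exact: (lb _ Sm.1).
by rewrite -lE; exact: H.
Qed.

Lemma principal_eigenvalueP {R : realType} (L lambda : R) (b : R -> R) k :
  is_principal_eigenvalue L lambda b k ->
  is_principal_eigenvalue L lambda b (principal_eigenvalue L lambda b).
Proof. by move=> pk; exact: (xgetPex 0 (ex_intro _ k pk)). Qed.

Lemma principal_eigenvalue_cst {R : realType} (L lambda b0 : R) : 0 < L -> 0 < lambda ->
  principal_eigenvalue L lambda (cst b0) = - (b0 + lambda ^+ 2).
Proof.
move=> L0 l0.
have c0 : continuous (fun _ : R => (0 : R)) by move=> x; exact: cvg_cst.
have [k pk] : exists k, is_principal_eigenvalue L lambda (cst b0) k.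
  have [||k] := @principal_eigenvalue_exists R L lambda 0 b0 (fun=> 0) L0 l0 c0 (fun=> erefl).
  - by move=> x; rewrite normr0.
  - by rewrite invr_ge0 mulr_ge0 ?sqr_ge0.
  - rewrite (_ : (fun x => _) = cst b0); first by exists k.
    by apply/funext => x; rewrite addr0.
have bE : {ae @lebesgue_measure R, forall x : R, cst b0 x = b0 + (fun=> 0) x}.
  by apply: aeW => x; rewrite addr0.
have [p [_ [rp _ _]]] := eigen_riccati L0 (principal_eigenvalueP pk) (bddmeas_cst 0 L 0) bE.
have p0 x : 0 <= x <= L -> p x = 0.
  move=> xL; apply/eqP; rewrite -normr_eq0; apply/negPn/negP => px.
  have {}px : 0 < `|p x| by rewrite lt_neqAle eq_sym px /=.
  (* For v = 0 every positive [eta] is a valid bound; this one gives |p x| <= |p x| / 2. *)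
  have e0 : 0 < `|p x| / (2 * L) by rewrite divr_gt0// mulr_gt0.
  have v0 z : 0 <= z <= L -> `|(fun=> 0 : R) z| <= `|p x| / (2 * L) by rewrite normr0 (ltW e0).
  have := riccati_sup rp e0 v0 xL; rewrite (_ : _ / _ * _ = `|p x| / 2); last by field; lra.
  lra.
have := riccati_mean rp.
have -> : Int 0 L (fun x => p x ^+ 2) = 0.
  rewrite (@eq_Int _ _ _ _ (fun=> 0)) ?Int_cst ?mul0r ?(ltW L0)//.
  by move=> x /p0 ->; rewrite expr0n.
rewrite Int_cst ?(ltW L0)// mul0r addr0 => /eqP; rewrite mulf_eq0 (gt_eqF L0) orbF => /eqP.
lra.
Qed.

Lemma minimal_speed_cst {R : realType} (L b0 : R) : 0 < L -> 0 < b0 ->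
  minimal_speed L (cst b0) = 2 * Num.sqrt b0.
Proof.
move=> L0 b00; have s0 : 0 < Num.sqrt b0 by rewrite sqrtr_gt0.
have sE : Num.sqrt b0 ^+ 2 = b0 by rewrite sqr_sqrtr// ltW.
rewrite (@speed_attained _ _ (Num.sqrt b0))// ?principal_eigenvalue_cst//.
  rewrite sE opprK -{1 2}sE; field; lra.
move=> l l0; rewrite principal_eigenvalue_cst// sE !opprK.
rewrite -{1 2 4}sE; set s := Num.sqrt b0 in s0 *.
rewrite ler_pdivlMr// [leLHS](_ : _ = 2 * s * l); last by field; lra.
have := sqr_ge0 (s - l); rewrite sqrrB; lra.
Qed.

(* q1 = p1 + lambda1 and q2 + (lambda1 - lambda2), with q2 = p2 + lambda2, have equal means. *)
Lemma eigenvalue_modulus {R : realType} (L l1 l2 k1 k2 b0 B : R) (b v : R -> R) p2 psi2 : 0 < L ->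
  is_principal_eigenvalue L l1 b k1 -> bddmeas 0 L v ->
  {ae @lebesgue_measure R, forall x, b x = b0 + v x} ->
  riccati L l2 (- k2 - l2 ^+ 2 - b0) v p2 ->
  primitive_on 0 L psi2 (fun x => p2 x * psi2 x) -> (forall x, 0 < psi2 x) ->
  (forall x, 0 <= x <= L -> `|p2 x + l2| <= B) ->
  k2 - k1 <= 2 * `|l1 - l2| * B + (l1 - l2) ^+ 2.
Proof.
move=> L0 pe1 bv bE r2 d2 psi20 qB.
have [p1 [psi1 [r1 d1 psi10]]] := eigen_riccati L0 pe1 bv bE.
have [_ _ dp1 pL1 Ip1] := r1; have [_ _ dp2 pL2 Ip2] := r2.
have bp1 := primitive_on_bddmeas dp1; have bp2 := primitive_on_bddmeas dp2.
rewrite leNgt; apply/negP => gap.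
set dl := l1 - l2 in gap.
pose d x := p1 x - p2 x.
(* With q_i = p_i + l_i one has q_i' = - k_i - b - q_i^2 and q1 - q2 = d + dl. Hence q1^2 - q2^2 = a
   d + 2 dl q2 + dl^2, and subtraction gives d' = s - a d. Since a = p1 + p2 + 2 l1, the function
   [E] is an integrating factor. *)
pose a x := p1 x + p2 x + (l1 + l2) + dl.
pose s x := k2 - k1 - 2 * dl * (p2 x + l2) - dl ^+ 2.
pose E x := psi1 x * psi2 x * exp2 (l1) x.
have bs : bddmeas 0 L s by rewrite /s; bddmeas_tac.
have dE : primitive_on 0 L E (fun x => a x * E x).
  have dex : primitive_on 0 L (exp2 l1) (fun x => 2 * l1 * exp2 l1 x).
    apply: primitive_on_C1T; first exact: is_derive_exp2.
    move=> x; apply: cvgM; first exact: cvg_cst.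
    exact: (is_derive_continuous (@is_derive_exp2 R l1)).
  have h := primitive_onM (primitive_onM d1 d2) dex.
  have bE' := primitive_on_bddmeas h; apply: (primitive_on_eq h) => // [x _|].
    by rewrite /a /E /dl; ring.
  suff [] : bddmeas 0 L (fun x => a x * E x) by [].
  by apply: bddmeasM => //; rewrite /a; bddmeas_tac.
have dd : primitive_on 0 L d (fun x => s x - a x * d x).
  have h := primitive_onD dp1 (primitive_onZ (-1) dp2).
  apply: (primitive_on_eq h) => [x _|x _|]; first by rewrite /d; ring.
    by rewrite /riccati_rhs /s /a /d /dl; ring.
  suff [] : bddmeas 0 L (fun x => s x - a x * d x) by [].
  by rewrite /a /d; bddmeas_tac.
apply: (@no_forced_periodic R L (k2 - k1 - (2 * `|dl| * B + dl ^+ 2)) d s a E) => //.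
- move=> x xL; have : `|2 * dl * (p2 x + l2)| <= 2 * `|dl| * B.
    by rewrite !normrM (ger0_norm (_ : 0 <= 2))// ler_wpM2l ?mulr_ge0// qB.
  by move=> /ler_normlP[_ h]; rewrite /s; lra.
- by rewrite subr_gt0.
- by move=> x; rewrite /E !mulr_gt0// expR_gt0.
- by rewrite /d pL1 pL2.
- by rewrite /d IntB// Ip1 Ip2 subrr.
Qed.

Lemma eigenvalue_dist {R : realType} (L l1 l2 k1 k2 b0 B eta : R) (b v : R -> R) : 0 < L ->
  0 < l1 <= B -> 0 < l2 <= B -> 0 < eta -> (forall x, 0 <= x <= L -> `|v x| <= eta) ->
  is_principal_eigenvalue L l1 b k1 -> is_principal_eigenvalue L l2 b k2 -> bddmeas 0 L v ->
  {ae @lebesgue_measure R, forall x, b x = b0 + v x} ->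
  `|k1 - k2| <= 2 * `|l1 - l2| * (B + eta * L) + (l1 - l2) ^+ 2.
Proof.
move=> L0 /andP[l10 l1B] /andP[l20 l2B] e0 ve pe1 pe2 bv bE.
have [p1 [psi1 [r1 d1 psi10]]] := eigen_riccati L0 pe1 bv bE.
have [p2 [psi2 [r2 d2 psi20]]] := eigen_riccati L0 pe2 bv bE.
have b1 x : 0 <= x <= L -> `|p1 x + l1| <= B + eta * L.
  move=> xL; apply: le_trans (ler_normD _ _) _; rewrite addrC (gtr0_norm l10).
  by apply: lerD => //; exact: (riccati_sup r1 e0).
have b2 x : 0 <= x <= L -> `|p2 x + l2| <= B + eta * L.
  move=> xL; apply: le_trans (ler_normD _ _) _; rewrite addrC (gtr0_norm l20).
  by apply: lerD => //; exact: (riccati_sup r2 e0).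
have h1 := eigenvalue_modulus L0 pe1 bv bE r2 d2 psi20 b2.
have h2 := eigenvalue_modulus L0 pe2 bv bE r1 d1 psi10 b1.
have e : (l2 - l1) ^+ 2 = (l1 - l2) ^+ 2 by ring.
rewrite distrC e in h2.
by rewrite ler_norml; apply/andP; split; lra.
Qed.

(** * The case of positive discriminant *)

Definition taylor_bound {R : realType} (f : R -> R) (b0 f1 f2 eps eta : R) : Prop :=
  forall v, `|v| <= eta -> `|f (b0 + v) - f b0 - f1 * v - f2 / 2 * v ^+ 2| <= eps * v ^+ 2.

(** The constraint fixes the integral of f (b0 + v), so integrating the expansion ties the mean of
    [v] to its square integral. *)
Lemma taylor_mean {R : realType} (L b0 f1 f2 eps eta : R) (f v : R -> R) : 0 < L ->
  taylor_bound f b0 f1 f2 eps eta -> bddmeas 0 L v -> (forall x, 0 <= x <= L -> `|v x| <= eta) ->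
  bddmeas 0 L (fun x => f (b0 + v x)) -> Int 0 L (fun x => f (b0 + v x)) = f b0 * L ->
  `|f1 * Int 0 L v + f2 / 2 * Int 0 L (fun x => v x ^+ 2)| <= eps * Int 0 L (fun x => v x ^+ 2).
Proof.
move=> L0 T bv ve bf If.
have E : Int 0 L (fun x => f (b0 + v x) - f b0 - f1 * v x - f2 / 2 * v x ^+ 2) =
    - (f1 * Int 0 L v + f2 / 2 * Int 0 L (fun x => v x ^+ 2)).
  rewrite !IntB; [|by bddmeas_tac..]; rewrite !IntZ; [|by bddmeas_tac..].
  by rewrite If Int_cst ?(ltW L0)//; ring.
rewrite -normrN -E -IntZ; last by bddmeas_tac.
have bF : bddmeas 0 L (fun x => f (b0 + v x) - f b0 - f1 * v x - f2 / 2 * v x ^+ 2) by bddmeas_tac.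
apply: le_trans (le_normr_Rintegral _ (bddmeas_integrable bF)) _ => //.
apply: le_Int; [exact: bddmeas_norm|by bddmeas_tac|].
by move=> x xL; apply: T; exact: ve.
Qed.

Lemma riccati_constant_lt0 {R : realType} (L s k delta f1 f2 m : R) (v p : R -> R) :
  riccati L s m v p -> (forall x, 0 <= x <= L -> `|p x| <= delta) -> 0 <= delta ->
  0 < k -> k * L < 2 * pi -> 0 < f1 -> 0 < Int 0 L (fun x => v x ^+ 2) ->
  f1 * Int 0 L v <= - (f2 / 2 - delta) * Int 0 L (fun x => v x ^+ 2) ->
  0 < k ^+ 2 + 4 * s ^+ 2 - delta - delta ^+ 2 ->
  f1 * (1 + delta) < (f2 / 2 - delta) * (k ^+ 2 + 4 * s ^+ 2 - delta - delta ^+ 2) ->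
  m < 0.
Proof.
move=> rp pd d0 k0 kL f10 V0 Tv X0 gap.
have := riccati_upper rp k0 kL d0 pd; have := riccati_mean rp.
set X := _ - delta ^+ 2 in X0 gap *.
set V := Int 0 L (fun x => v x ^+ 2) in V0 Tv *.
set P := Int 0 L (fun x => p x ^+ 2); set Iv := Int 0 L v in Tv *.
have [L0 _ _ _ _] := rp.
move=> mE hP.
have h1 : X * (f1 * Iv) <= X * (- (f2 / 2 - delta) * V) by rewrite ler_pM2l.
have h2 : f1 * (X * P) <= f1 * ((1 + delta) * V) by rewrite ler_pM2l.
have h3 : (f1 * (1 + delta)) * V < ((f2 / 2 - delta) * X) * V by rewrite ltr_pM2r.
have h4 : (X * f1 * L) * m < 0.
  have -> : X * f1 * L * m = X * f1 * (m * L) by ring.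
  rewrite mE; lra.
by move: h4; rewrite pmulr_rlt0// !mulr_gt0.
Qed.

(** A single [delta] serves as Taylor error, as bound on |p| and as relative loss of frequency, k =
    w (1 - delta) with w = 2 pi / L. [W] bounds the loss of the weight per unit of [delta], and [K]
    the total loss of the gap. *)
Lemma choose_gap {R : realType} (L b0 f1 f2 : R) : 0 < L -> 0 < b0 -> 0 < f1 -> 0 < f2 ->
  0 < 2 * f2 * (pi ^+ 2 / L ^+ 2 + b0) - f1 ->
  exists k delta : R, [/\ 0 < k, k * L < 2 * pi, 0 < delta,
     0 < k ^+ 2 + 4 * b0 - delta - delta ^+ 2 &
     f1 * (1 + delta) < (f2 / 2 - delta) * (k ^+ 2 + 4 * b0 - delta - delta ^+ 2)].
Proof.
move=> L0 b00 f10 f20 D0.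
pose w : R := 2 * pi / L.
have w0 : 0 < w by rewrite divr_gt0// mulr_gt0// pi_gt0.
pose Q := w ^+ 2 + 4 * b0.
have DE : 2 * f2 * (pi ^+ 2 / L ^+ 2 + b0) - f1 = f2 / 2 * Q - f1.
  by rewrite /Q /w; field; lra.
rewrite DE in D0.
have Q0 : 0 < Q by rewrite /Q addr_gt0// ?exprn_gt0// mulr_gt0.
pose W := 2 * w ^+ 2 + 2.
have W0 : 0 < W by rewrite /W; have := exprn_gt0 2 w0; lra.
pose K := Q + f2 / 2 * W + f1 + W.
have K0 : 0 < K by rewrite /K; have : 0 < f2 / 2 * W; [rewrite mulr_gt0//; lra|lra].
set D := f2 / 2 * Q - f1 in D0.
pose delta := Num.min 2^-1 (Num.min (D / (2 * K)) (Q / (2 * W))).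
have d0 : 0 < delta.
  rewrite !lt_min; apply/and3P; split; first by rewrite invr_gt0.
    by apply: divr_gt0 => //; rewrite mulr_gt0.
  by apply: divr_gt0 => //; rewrite mulr_gt0.
have d1 : delta <= 2^-1 by rewrite ge_min lexx.
have d2 : delta <= D / (2 * K) by rewrite !ge_min lexx orbT.
have d3 : delta <= Q / (2 * W) by rewrite !ge_min lexx !orbT.
rewrite ler_pdivlMr ?mulr_gt0// in d2; rewrite ler_pdivlMr ?mulr_gt0// in d3.
have w20 : 0 < w ^+ 2 by rewrite exprn_gt0.
have dd : delta ^+ 2 <= delta by rewrite expr2; nra.
have kE : (w * (1 - delta)) ^+ 2 >= w ^+ 2 - 2 * delta * w ^+ 2.
  have : 0 <= delta ^+ 2 * w ^+ 2 by rewrite mulr_ge0 ?sqr_ge0.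
  rewrite (_ : (w * (1 - delta)) ^+ 2 = w ^+ 2 - 2 * delta * w ^+ 2 + delta ^+ 2 * w ^+ 2); last by ring.
  lra.
have X1 : Q - delta * W <= (w * (1 - delta)) ^+ 2 + 4 * b0 - delta - delta ^+ 2.
  by rewrite /Q /W; lra.
exists (w * (1 - delta)), delta; split => //.
- by rewrite mulr_gt0//; lra.
- rewrite (_ : w * (1 - delta) * L = 2 * pi * (1 - delta)); last by rewrite /w; field; lra.
  have := @pi_gt0 R; nra.
- lra.
have h1 : 0 <= delta * (delta * W) by rewrite !mulr_ge0// ltW.
have h2 : 0 < f2 / 2 - delta.
  rewrite subr_gt0; have : delta * (2 * Q) < f2 * Q by rewrite /K /D in d2; nra.
  by rewrite mulrA ltr_pM2r//; lra.
apply: lt_le_trans (_ : (f2 / 2 - delta) * (Q - delta * W) <= _); last by rewrite ler_wpM2l// ltW.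
rewrite /K /D in d2 D0; have dW : 0 < delta * W by rewrite mulr_gt0.
lra.
Qed.

(** Truncation to [c - eta, c + eta] turns an almost everywhere bound into a bound at every point
    without leaving the class of [b]. *)
Definition clip {R : realType} (c eta x : R) : R := Num.max (c - eta) (Num.min x (c + eta)).

Lemma clip_cases {R : realType} (c eta x : R) : 0 <= eta ->
  [\/ x < c - eta /\ clip c eta x = c - eta, c - eta <= x <= c + eta /\ clip c eta x = x |
      c + eta < x /\ clip c eta x = c + eta].
Proof.
move=> e0; rewrite /clip.
have [h1|h1] := leP x (c + eta).
  have [h2|h2] := leP (c - eta) x; [by apply: Or32; split => //; apply/andP|exact: Or31].
apply: Or33; split => //; have [//|] := leP (c - eta) (c + eta); lra.
Qed.

Lemma clip_lipschitz {R : realType} (c eta x y : R) : 0 <= eta -> x <= y -> `|clip c eta y - clip c eta x| <= 1 * (y - x).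
Proof.
move=> e0 xy; rewrite ler_norml; apply/andP.
case: (clip_cases c x e0) => [] [h1 ->]; case: (clip_cases c y e0) => [] [h2 ->]; split; lra.
Qed.

Lemma clip_bound {R : realType} (c eta x : R) : 0 <= eta -> `|clip c eta x - c| <= eta.
Proof.
move=> e0; rewrite ler_norml; apply/andP.
case: (clip_cases c x e0) => [] [h1 ->]; split; lra.
Qed.

Lemma clip_id {R : realType} (c eta x : R) : `|c - x| <= eta -> clip c eta x = x.
Proof.
move=> cx; have e0 := le_trans (normr_ge0 _) cx; have /ler_normlP[h1 h2] := cx.
case: (clip_cases c x e0) => [] [h3 ->]; lra.
Qed.

Lemma clip_eq {R : realType} (c eta x : R) : 0 < eta -> clip c eta x = c -> x = c.
Proof. move=> e0; case: (clip_cases c x (ltW e0)) => [] [h3 ->]; lra. Qed.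

Lemma clip_continuous {R : realType} (c eta : R) : 0 <= eta -> continuous (clip c eta).
Proof. by move=> e0; apply: (@lipschitz_continuous R 1) => // x y; exact: clip_lipschitz. Qed.

Lemma local_max_core {R : realType} (L beta b0 f1 f2 : R) (f : R -> R) : 0 < L -> 0 < b0 -> f b0 = beta ->
  (forall x, 0 < x -> {for x, continuous f}) -> 0 < f1 -> 0 < f2 ->
  (forall eps, 0 < eps -> exists2 eta, 0 < eta & taylor_bound f b0 f1 f2 eps eta) ->
  0 < 2 * f2 * (pi ^+ 2 / L ^+ 2 + b0) - f1 ->
  strict_local_maximizer (minimal_speed L) (admissible f L beta) (cst b0).
Proof.
move=> L0 b00 fb0 cf f10 f20 T D0.
have [k [delta [k0 kL d0 X0 gap]]] := choose_gap L0 b00 f10 f20 D0.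
have [eta0 eta00 T0] := T _ d0.
(* The three bounds ensure the Taylor estimate, |p| <= eta L <= delta, and positivity of the
   truncated values. *)
pose eta := Num.min eta0 (Num.min (delta / L) (b0 / 2)).
have e0 : 0 < eta by rewrite !lt_min eta00 !divr_gt0.
have e1 : eta <= eta0 by rewrite ge_min lexx.
have e2 : eta * L <= delta by rewrite -ler_pdivlMr// !ge_min lexx orbT.
have e3 : eta <= b0 / 2 by rewrite !ge_min lexx !orbT.
exists eta => // b [lb pb b_ge0 ifb mfb] dist0 /Linfty_dist_leP dist.
pose s := Num.sqrt b0.
have s0 : 0 < s by rewrite sqrtr_gt0.
have sE : s ^+ 2 = b0 by rewrite sqr_sqrtr// ltW.
rewrite minimal_speed_cst//; apply: (speed_bound s0); first by rewrite mulr_gt0.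
move=> e pe.
have [mb _ _] := lb.
pose v x := clip b0 eta (b x) - b0.
have vb x : `|v x| <= eta by apply: clip_bound; exact: ltW.
have mc : measurable_fun setT (fun x => clip b0 eta (b x)).
  apply: measurableT_comp => //; apply: continuous_measurable_fun; apply: clip_continuous; exact: ltW.
have bv : bddmeas 0 L v.
  split; last by exists eta => x _.
  by apply: measurable_funB; [exact: measurable_funTS|exact: measurable_cst].
have vE x : b0 + v x = clip b0 eta (b x) by rewrite /v; ring.
have bE : {ae @lebesgue_measure R, forall x, b x = b0 + v x}.
  have F := ae_filter_ringOfSetsType (@lebesgue_measure R).
  by apply: (@filterS _ _ F) dist => x /clip_id h; rewrite vE.
have cpos x : 0 < clip b0 eta x.
  by have /ler_normlP[] := @clip_bound _ b0 eta x (ltW e0); lra.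
have cfc : continuous (fun x => f (clip b0 eta x)).
  move=> x; apply: continuous_comp; first by apply: clip_continuous; exact: ltW.
  exact: cf.
have mfv : measurable_fun `[0, L] (fun x => f (b0 + v x)).
  rewrite (_ : (fun x => _) = (fun x => f (clip b0 eta (b x)))); last by apply/funext => x; rewrite vE.
  by apply: measurable_funTS; apply: (measurableT_comp (continuous_measurable_fun cfc)).
have bf : bddmeas 0 L (fun x => f (b0 + v x)).
  split=> //; exists (`|f b0| + `|f1| * eta + `|f2 / 2| * eta ^+ 2 + delta * eta ^+ 2) => x _.
  have h := T0 _ (le_trans (vb x) e1).
  have v2 : v x ^+ 2 <= eta ^+ 2.
    by rewrite -(real_normK (num_real (v x))) lerXn2r ?nnegrE// ltW.
  have -> : f (b0 + v x) = f b0 + f1 * v x + f2 / 2 * v x ^+ 2 + (f (b0 + v x) - f b0 - f1 * v x - f2 / 2 * v x ^+ 2) by ring.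
  apply: le_trans (ler_normD _ _) _; apply: lerD; last first.
    by apply: le_trans h _; rewrite ler_pM2l.
  apply: le_trans (ler_normD _ _) _; apply: lerD; last first.
    by rewrite normrM ler_wpM2l// ger0_norm ?sqr_ge0.
  apply: le_trans (ler_normD _ _) _; apply: lerD => //.
  by rewrite normrM ler_wpM2l.
have If : Int 0 L (fun x => f (b0 + v x)) = f b0 * L.
  rewrite fb0 -mfb mulrAC mulVf ?gt_eqF// mul1r /Rintegral; congr fine.
  apply: ae_eq_integral => //.
  - exact/measurable_EFinP.
  - by have /integrableP[] := ifb.
  - have F := ae_filter_ringOfSetsType (@lebesgue_measure R).
    by apply: (@filterS _ _ F) bE => x <- _.
have Tv := taylor_mean L0 T0 bv (fun x _ => le_trans (vb x) e1) bf If.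
(* If this integral vanished, periodicity would give b = b0 almost everywhere, against the positive
   distance. *)
have V0 : 0 < Int 0 L (fun x => v x ^+ 2).
  rewrite ltNge; apply/negP => /(int_sqr_eq0 bv) Z.
  suff : {ae @lebesgue_measure R, forall x, b x = b0}.
    by move=> /Linfty_dist_eq0 h; rewrite h ltxx in dist0.
  apply: (ae_periodic L0 pb mb).
  rewrite -[RHS]Z; congr (lebesgue_measure (_ `&` _)); apply/seteqP; split => x /=.
    by apply: contraNN; rewrite /v subr_eq0 => /eqP /(clip_eq e0) ->.
  apply: contraNN => /eqP bx; rewrite /v bx clip_id ?subrr//.
  by rewrite normr0 ltW.
have [p [psi [rp _ _]]] := eigen_riccati L0 pe bv bE.
have pd x : 0 <= x <= L -> `|p x| <= delta.
  by move=> xL; apply: le_trans e2; exact: (riccati_sup rp e0 (fun x _ => vb x)).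
have Tv' : f1 * Int 0 L v <= - (f2 / 2 - delta) * Int 0 L (fun x => v x ^+ 2).
  by have /ler_normlP[h1 h2] := Tv; lra.
rewrite -sE in X0 gap.
have := riccati_constant_lt0 rp pd (ltW d0) k0 kL f10 V0 Tv' X0 gap.
rewrite sE => h; rewrite ltr_pdivrMr// -mulrA -expr2 sE; lra.
Qed.

(** * Cosine perturbations *)

Definition freq {R : realType} (L : R) (n : nat) : R := 2 * pi * n%:R / L.

Lemma freq_gt0 {R : realType} (L : R) n : 0 < L -> (0 < n)%N -> 0 < freq L n.
Proof. by move=> L0 n0; rewrite divr_gt0// !mulr_gt0 ?pi_gt0// ltr0n. Qed.

Lemma freqL {R : realType} (L : R) n : 0 < L -> freq L n * L = (pi *+ 2) *+ n.
Proof. by move=> L0; rewrite /freq mulfVK ?gt_eqF// mulr_natr mulr_natl. Qed.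

Lemma cos_freq_periodic {R : realType} (L : R) n : 0 < L -> Defs.periodic L (fun x => cos (freq L n * x)).
Proof. by move=> L0 x; rewrite mulrDr freqL//; exact: periodicn (@cosD2pi R) n _. Qed.

Lemma cos_freqL {R : realType} (L : R) n : 0 < L -> cos (freq L n * L) = 1.
Proof. by move=> L0; have := cos_freq_periodic n L0 0; rewrite add0r mulr0 cos0. Qed.

Lemma sin_freqL {R : realType} (L : R) n : 0 < L -> sin (freq L n * L) = 0.
Proof.
move=> L0; rewrite freqL// -[_ *+ n]add0r.
by rewrite (periodicn (@sinD2pi R) n) sin0.
Qed.

Lemma is_derive_cosM {R : realType} (w x : R) : is_derive x 1 (fun x => cos (w * x)) (- (w * sin (w * x))).
Proof. by apply: is_derive_eq; rewrite /GRing.scale/=; ring. Qed.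

Lemma is_derive_sinM {R : realType} (w x : R) : is_derive x 1 (fun x => sin (w * x)) (w * cos (w * x)).
Proof. by apply: is_derive_eq; rewrite /GRing.scale/=; ring. Qed.

Lemma cosM_continuous {R : realType} (w : R) : continuous (fun x => cos (w * x)).
Proof. exact: is_derive_continuous (is_derive_cosM w). Qed.

Lemma sinM_continuous {R : realType} (w : R) : continuous (fun x => sin (w * x)).
Proof. exact: is_derive_continuous (is_derive_sinM w). Qed.

(** The linear and mixed integrals have periodic primitives. The two squares have integrals with sum
    L and difference 0, as cos^2 - sin^2 is proportional to the derivative of sin cos. *)
Lemma Int_freq {R : realType} (L : R) n (w := freq L n) : 0 < L -> (0 < n)%N ->
  [/\ Int 0 L (fun x => cos (w * x)) = 0, Int 0 L (fun x => sin (w * x)) = 0,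
      Int 0 L (fun x => cos (w * x) ^+ 2) = L / 2, Int 0 L (fun x => sin (w * x) ^+ 2) = L / 2 &
      Int 0 L (fun x => sin (w * x) * cos (w * x)) = 0].
Proof.
move=> L0 n0; have w0 : 0 < w by exact: freq_gt0.
have cL : cos (w * L) = 1 by exact: cos_freqL.
have sL : sin (w * L) = 0 by exact: sin_freqL.
have bc : bddmeas 0 L (fun x => cos (w * x)) by apply: bddmeas_cont; exact: cosM_continuous.
have bs : bddmeas 0 L (fun x => sin (w * x)) by apply: bddmeas_cont; exact: sinM_continuous.
have ds : primitive_on 0 L (fun x => sin (w * x)) (fun x => w * cos (w * x)).
  apply: primitive_on_C1T; first exact: is_derive_sinM.
  by move=> x; apply: cvgM; [exact: cvg_cst|exact: cosM_continuous].
have dc : primitive_on 0 L (fun x => cos (w * x)) (fun x => - (w * sin (w * x))).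
  apply: primitive_on_C1T; first exact: is_derive_cosM.
  by move=> x; apply: cvgN; apply: cvgM; [exact: cvg_cst|exact: sinM_continuous].
have dss := primitive_onM ds ds; have dsc := primitive_onM ds dc.
have cancelw (X : R) : w * X = 0 -> X = 0.
  by move=> /eqP; rewrite mulf_eq0 gt_eqF//= => /eqP.
have c1 : Int 0 L (fun x => cos (w * x)) = 0.
  apply: cancelw; rewrite -IntZ//.
  by apply: (primitive_on_int0 (ltW L0) ds); rewrite sL mulr0 sin0.
have s1 : Int 0 L (fun x => sin (w * x)) = 0.
  apply: cancelw; rewrite -IntZ//.
  have := primitive_on_int0 (ltW L0) (primitive_onZ (-1) dc); rewrite cL mulr0 cos0 => /(_ erefl) h.
  by rewrite -[RHS]h; apply: eq_Int => x _; ring.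
have sc : Int 0 L (fun x => sin (w * x) * cos (w * x)) = 0.
  apply: (cancelw); apply: (_ : forall X : R, 2 * X = 0 -> X = 0); first by move=> X; lra.
  rewrite -IntZ; last by bddmeas_tac. rewrite -IntZ; last by bddmeas_tac.
  have := primitive_on_int0 (ltW L0) dss; rewrite sL mulr0 sin0 => /(_ erefl) h.
  by rewrite -[RHS]h; apply: eq_Int => x _; ring.
have sum : Int 0 L (fun x => cos (w * x) ^+ 2) + Int 0 L (fun x => sin (w * x) ^+ 2) = L.
  rewrite -IntD; [|by bddmeas_tac..].
  rewrite (@eq_Int _ _ _ _ (fun=> 1)) ?Int_cst ?(ltW L0)//; first by rewrite mul1r subr0.
  by move=> x _; exact: cos2Dsin2.
have dif : Int 0 L (fun x => cos (w * x) ^+ 2) - Int 0 L (fun x => sin (w * x) ^+ 2) = 0.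
  rewrite -IntB; [|by bddmeas_tac..]; apply: cancelw; rewrite -IntZ; last by bddmeas_tac.
  have := primitive_on_int0 (ltW L0) dsc; rewrite sL mulr0 sin0 !mul0r => /(_ erefl) h.
  by rewrite -[RHS]h; apply: eq_Int => x _; ring.
by split => //; lra.
Qed.

Definition wave {R : realType} (L : R) (n : nat) (e t x : R) : R := e * cos (freq L n * x) + t.

Lemma wave_continuous {R : realType} (L : R) n e t : continuous (wave L n e t).
Proof.
move=> x; apply: cvgD; last exact: cvg_cst.
by apply: cvgM; [exact: cvg_cst|exact: cosM_continuous].
Qed.

Lemma wave_periodic {R : realType} (L : R) n e t : 0 < L -> Defs.periodic L (wave L n e t).
Proof. by move=> L0 x; rewrite /wave cos_freq_periodic. Qed.

Lemma wave_bound {R : realType} (L : R) n e t x : 0 <= e -> - e <= t <= 0 -> `|wave L n e t x| <= 2 * e.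
Proof.
move=> e0 te; rewrite /wave; have := cos_geN1 (freq L n * x); have := cos_le1 (freq L n * x).
set c := cos _ => c1 c2; rewrite ler_norml; apply/andP; split; nra.
Qed.

Lemma wave_int {R : realType} (L : R) n e t : 0 < L -> (0 < n)%N ->
  Int 0 L (wave L n e t) = t * L /\ Int 0 L (fun x => wave L n e t x ^+ 2) = L * (e ^+ 2 / 2 + t ^+ 2).
Proof.
move=> L0 n0; have [c1 _ c2 _ _] := Int_freq L0 n0.
have bc : bddmeas 0 L (fun x => cos (freq L n * x)) by apply: bddmeas_cont; exact: cosM_continuous.
rewrite /wave; split.
  rewrite IntD; [|by bddmeas_tac..]; rewrite IntZ; last by bddmeas_tac.
  by rewrite c1 Int_cst ?(ltW L0)//; ring.
rewrite (@eq_Int _ _ _ _ (fun x => e ^+ 2 * cos (freq L n * x) ^+ 2 + (2 * e * t) * cos (freq L n * x) + t ^+ 2)).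
  rewrite !IntD; [|by bddmeas_tac..]; rewrite !IntZ; [|by bddmeas_tac..].
  by rewrite c1 c2 Int_cst ?(ltW L0)//; field.
by move=> x _; ring.
Qed.

(** [t] comes from the intermediate value theorem. At t = - e the wave is nonpositive and
    monotonicity of [f] makes the mean at most beta; at t = 0 it has zero mean and the positive
    second-order term makes the mean at least beta. *)
Lemma wave_admissible {R : realType} (L beta b0 f1 f2 eps eta e : R) (f : R -> R) n :
  0 < L -> (0 < n)%N -> 0 < b0 -> f b0 = beta ->
  {in `[0, +oo[ &, {homo f : x y / x < y}} ->
  (forall x, 0 < x -> derivable f x 1 /\ derivable (derive1 f) x 1) ->
  taylor_bound f b0 f1 f2 eps eta -> eps <= f2 / 2 ->
  0 < e -> 2 * e <= eta -> 2 * e <= b0 / 2 ->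
  exists t, [/\ - e <= t <= 0, admissible f L beta (fun x => b0 + wave L n e t x) &
    `|f1 * t + f2 / 2 * (e ^+ 2 / 2 + t ^+ 2)| <= eps * (e ^+ 2 / 2 + t ^+ 2)].
Proof.
move=> L0 n0 b00 fb0 finc df T ef e0 ee eb.
have cf x : 0 < x -> {for x, continuous f}.
  by move=> /df[dfx _]; apply: differentiable_continuous; exact/derivable1_diffP.
have cdf x : 0 < x -> {for x, continuous (derive1 f)}.
  by move=> /df[_ dfx]; apply: differentiable_continuous; exact/derivable1_diffP.
have bpos t x : - e <= t <= 0 -> b0 / 2 <= b0 + wave L n e t x <= b0 + b0 / 2.
  move=> te; have /ler_normlP[h1 h2] := wave_bound L n x (ltW e0) te.
  by apply/andP; split; lra.
have cfb t : - e <= t <= 0 -> continuous (fun x => f (b0 + wave L n e t x)).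
  move=> te x; apply: (@continuous_comp _ _ _ (fun x => b0 + wave L n e t x) f).
    by apply: cvgD; [exact: cvg_cst|exact: wave_continuous].
  by apply: cf; have := bpos t x te; lra.
(* A bound of f' on the range of all these waves makes the constraint integral Lipschitz in [t]. *)
have [M fM] : exists M, forall x, b0 / 2 <= x <= b0 + b0 / 2 -> `|derive1 f x| <= M.
  apply: within_continuous_bounded; apply: continuous_in_subspaceT => x; rewrite inE /= in_itv /= => xb.
  apply: cdf; lra.
have M0 : 0 <= M by apply: le_trans (fM b0 _); [exact: normr_ge0|lra].
have flip x y : b0 / 2 <= x -> x <= y -> y <= b0 + b0 / 2 -> `|f y - f x| <= M * (y - x).
  move=> bx xy yb.
  have cw : {within `[x, y], continuous f}.
    by apply: continuous_in_subspaceT => z; rewrite inE /= in_itv /= => zb; apply: cf; lra.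
  have dw z : z \in `]x, y[ -> is_derive z 1 f (derive1 f z).
    rewrite in_itv /= => zb; rewrite derive1E; apply: derivableP.
    exact: (df z (lt_le_trans (divr_gt0 b00 (ltr0n R 2)) (le_trans bx (ltW (andP zb).1)))).1.
  have [c cxy ->] := MVT_segment xy dw cw.
  rewrite normrM (ger0_norm (_ : 0 <= y - x)) ?subr_ge0// ler_wpM2r ?subr_ge0//.
  by apply: fM; move: cxy; rewrite in_itv /=; lra.
pose F t := Int 0 L (fun x => f (b0 + wave L n e t x)).
have bF t : - e <= t <= 0 -> bddmeas 0 L (fun x => f (b0 + wave L n e t x)).
  by move=> te; apply: bddmeas_cont; exact: cfb.
have cF : {within `[(- e), 0], continuous F}.
  apply: (@lipschitz_within _ _ _ (M * L)); first by rewrite mulr_ge0// ltW.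
  move=> t1 t2 t1e t12 t20.
  have te1 : - e <= t1 <= 0 by lra.
  have te2 : - e <= t2 <= 0 by lra.
  rewrite /F -IntB; [|exact: bF..].
  rewrite mulrAC -[X in _ * X](subr0 L); apply: norm_Int_le; [exact: ltW|by apply: bddmeasB; exact: bF|].
  move=> x _; have := bpos t1 x te1; have := bpos t2 x te2 => h2 h1.
  have -> : t2 - t1 = (b0 + wave L n e t2 x) - (b0 + wave L n e t1 x) by rewrite /wave; ring.
  by apply: flip; rewrite /wave in h1 h2 *; lra.
have Fl : F (- e) <= beta * L.
  rewrite -[X in _ * X](subr0 L) -Int_cst ?(ltW L0)//; apply: le_Int; [by apply: bF; lra|exact: bddmeas_cst|].
  move=> x _; rewrite -fb0.
  have te : - e <= - e <= 0 by rewrite lexx oppr_le0 ltW.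
  have /andP[hb _] := bpos _ x te.
  have wle : b0 + wave L n e (- e) x <= b0.
    rewrite /wave gerDl -[X in _ + X]mulrN1 -mulrDr pmulr_rle0// subr_le0; exact: cos_le1.
  move: wle; rewrite le_eqVlt => /predU1P[->//|h].
  apply/ltW/finc => //; rewrite in_itv /= andbT; last exact: ltW.
  by apply: le_trans hb; rewrite divr_ge0// ltW.
have te0 : - e <= (0 : R) <= 0 by rewrite lexx oppr_le0 ltW.
have Fr : beta * L <= F 0.
  have [w1 w2] := wave_int e 0 L0 n0.
  have bw : bddmeas 0 L (wave L n e 0) by apply: bddmeas_cont; exact: wave_continuous.
  have : Int 0 L (fun x => beta + f1 * wave L n e 0 x + (f2 / 2 - eps) * wave L n e 0 x ^+ 2) <= F 0.
    apply: le_Int; [by bddmeas_tac|exact: bF|].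
    move=> x _; have := T _ (le_trans (wave_bound L n x (ltW e0) te0) ee).
    by rewrite fb0 => /ler_normlP[h1 h2]; lra.
  rewrite !IntD; [|by bddmeas_tac..]; rewrite !IntZ; [|by bddmeas_tac..].
  rewrite w1 w2 Int_cst ?(ltW L0)//.
  have : 0 <= (f2 / 2 - eps) * (L * (e ^+ 2 / 2 + 0 ^+ 2)).
    rewrite mulr_ge0 ?subr_ge0// mulr_ge0 ?(ltW L0)// expr0n addr0.
    by rewrite divr_ge0// sqr_ge0.
  lra.
have [t /[!in_itv]/= te Ft] : exists2 t, t \in `[(- e), 0] & F t = beta * L.
  by apply: IVT => //; [lra|rewrite ge_min le_max Fl Fr orbT].
have bw : bddmeas 0 L (wave L n e t) by apply: bddmeas_cont; exact: wave_continuous.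
have cb : continuous (fun x => b0 + wave L n e t x).
  by move=> x; apply: cvgD; [exact: cvg_cst|exact: wave_continuous].
exists t; split => //; first split.
- exact: continuous_locally_integrable.
- by move=> x; rewrite wave_periodic.
- by move=> x; have := bpos t x te; lra.
- by apply: bddmeas_integrable; exact: bF.
- by rewrite -/(F t) Ft mulrCA mulVf ?gt_eqF// mulr1.
have := taylor_mean L0 T bw (fun x _ => le_trans (wave_bound L n x (ltW e0) te) ee) (bF t te).
rewrite -/(F t) Ft fb0 => /(_ erefl).
have [-> ->] := wave_int e t L0 n0.
rewrite (_ : f1 * (t * L) + _ = (f1 * t + f2 / 2 * (e ^+ 2 / 2 + t ^+ 2)) * L); last by ring.
by rewrite normrM (gtr0_norm L0) (mulrCA eps) (mulrC L) ler_pM2r.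
Qed.

Lemma wave_dist {R : realType} (L : R) n (b0 e t : R) : 0 <= e -> - e <= t <= 0 ->
  (Linfty_dist (cst b0) (fun x => b0 + wave L n e t x)%R <= (2 * e)%:E)%E.
Proof.
move=> e0 te; apply/Linfty_dist_leP; apply: aeW => x /=.
by rewrite opprD addrA subrr sub0r normrN; exact: wave_bound.
Qed.

Lemma ae_refl {R : realType} (f : R -> R) : {ae @lebesgue_measure R, forall x, f x = f x}.
Proof. exact: aeW. Qed.

(** * Failure of local minimality: waves of high frequency *)

Lemma freq_large {R : realType} (L G : R) : 0 < L -> exists2 n : nat, (0 < n)%N & G < freq L n.
Proof.
move=> L0; pose X := `|G| * L / (2 * pi).
have p0 : 0 < 2 * pi :> R by rewrite mulr_gt0// pi_gt0.
have X0 : 0 <= X by apply: divr_ge0; [apply: mulr_ge0; [exact: normr_ge0|exact: ltW]|exact: ltW].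
have nX := archi_boundP X0; exists (Num.bound X).
  by rewrite -(ltr0n R); apply: le_lt_trans nX.
apply: le_lt_trans (ler_norm G) _.
have gen (c : R) : 0 < c -> `|G| = c * (`|G| * L / c) / L by move=> c0; field; rewrite !gt_eqF.
rewrite (gen _ p0) -/X.
by rewrite /freq ltr_pM2r ?invr_gt0// ltr_pM2l.
Qed.

Lemma not_local_min_core {R : realType} (L beta b0 f1 f2 : R) (f : R -> R) : 0 < L -> 0 < b0 -> f b0 = beta ->
  {in `[0, +oo[ &, {homo f : x y / x < y}} ->
  (forall x, 0 < x -> derivable f x 1 /\ derivable (derive1 f) x 1) -> 0 < f1 -> 0 < f2 ->
  (forall eps, 0 < eps -> exists2 eta, 0 < eta & taylor_bound f b0 f1 f2 eps eta) ->
  ~ local_minimizer (minimal_speed L) (admissible f L beta) (cst b0).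
Proof.
move=> L0 b00 fb0 finc df f10 f20 T [eta0 eta00 H].
have [eta1 eta10 T1] := T (f2 / 4) (divr_gt0 f20 (ltr0n R 4)).
pose s := Num.sqrt b0.
have s0 : 0 < s by rewrite sqrtr_gt0.
have sE : s ^+ 2 = b0 by rewrite sqr_sqrtr// ltW.
(* The mean of [v] contributes at most - f2 e^2 / 8 to f1 m, and p^2 at most 3 f1 e^2 / (2 w^2);
   their sum is negative once f2 w^2 > 12 f1. The added 1 ensures w <= w^2, and the frequency is
   chosen before the amplitude. *)
have [n n0 nG] := freq_large (12 * f1 / f2 + 1) L0.
set w := freq L n in nG.
have w0 : 0 < w by exact: freq_gt0.
have wG : 12 * f1 < f2 * w ^+ 2.
  have h : 0 < 12 * f1 / f2 by rewrite divr_gt0// mulr_gt0.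
  rewrite [ltRHS]mulrC -ltr_pdivrMr//.
  have : w <= w ^+ 2 by rewrite expr2 ler_peMl ?(ltW w0)//; lra.
  lra.
(* The wave is bounded by 2 e, hence the halves; the last entry gives |p| <= 2 e L <= s, as the
   oscillation estimate at lambda = s demands. *)
pose e := Num.min (Num.min (eta0 / 2) (eta1 / 2)) (Num.min (b0 / 4) (s / (2 * L))).
have e0 : 0 < e.
  by rewrite !lt_min !(divr_gt0 eta00, divr_gt0 eta10, divr_gt0 b00, divr_gt0 s0)// mulr_gt0.
have e1 : e <= eta0 / 2 by rewrite !ge_min lexx.
have e2 : e <= eta1 / 2 by rewrite !ge_min lexx !orbT.
have e3 : e <= b0 / 4 by rewrite !ge_min lexx !orbT.
have e4 : e * (2 * L) <= s by rewrite -ler_pdivlMr ?mulr_gt0// !ge_min lexx !orbT.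
have [t [te bA tb]] := @wave_admissible R L beta b0 f1 f2 (f2 / 4) eta1 e f n L0 n0 b00 fb0 finc df T1
  ltac:(lra) e0 ltac:(lra) ltac:(lra).
have := H _ bA (le_trans (wave_dist L n b0 (ltW e0) te) _).
rewrite lee_fin => /(_ ltac:(lra)); rewrite minimal_speed_cst//.
apply/negP; rewrite -ltNge; apply: (speed_bound s0); first by rewrite mulr_gt0.
move=> k pe.
have bw : bddmeas 0 L (wave L n e t) by apply: bddmeas_cont; exact: wave_continuous.
have [p [psi [rp _ _]]] := eigen_riccati L0 pe bw (ae_refl (fun x => b0 + wave L n e t x)).
have e20 : 0 < 2 * e by rewrite mulr_gt0.
have ps x : 0 <= x <= L -> `|p x| <= s.
  move=> xL; apply: le_trans e4.
  rewrite (_ : e * _ = 2 * e * L); last by ring.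
  exact: (riccati_sup rp e20 (fun x _ => wave_bound L n x (ltW e0) te)).
have dV : primitive_on 0 L (fun x => e / w * sin (w * x)) (fun x => e * cos (w * x)).
  apply: primitive_on_C1T => x; last by apply: cvgM; [exact: cvg_cst|exact: cosM_continuous].
  by apply: is_derive_eq; rewrite /GRing.scale/=; field; rewrite gt_eqF.
have [_ s1 _ s2 _] := Int_freq L0 n0; rewrite -/w in s1 s2.
have bs : bddmeas 0 L (fun x => sin (w * x)) by apply: bddmeas_cont; exact: sinM_continuous.
have IV : Int 0 L (fun x => e / w * sin (w * x)) = 0 by rewrite IntZ// s1 mulr0.
have V0L : e / w * sin (w * 0) = e / w * sin (w * L).
  by rewrite /w sin_freqL// mulr0 sin0.
have := riccati_oscillation rp (fun x _ => erefl) dV V0L IV s0 ps.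
rewrite (@eq_Int _ _ _ (fun x => (e / w * sin (w * x)) ^+ 2) (fun x => (e / w) ^+ 2 * sin (w * x) ^+ 2)); last first.
  by move=> x _; rewrite exprMn.
rewrite IntZ ?s2; last by bddmeas_tac.
have := riccati_mean rp; have [-> _] := wave_int e t L0 n0.
set P := Int 0 L (fun x => p x ^+ 2) => mE hP.
set m := - k - s ^+ 2 - b0 in mE.
have t2 : f1 * t <= - (f2 / 4) * (e ^+ 2 / 2).
  have /ler_normlP[_ h] := tb.
  have : 0 <= f2 * t ^+ 2 by rewrite mulr_ge0 ?sqr_ge0// ltW.
  lra.
have m0 : m < 0.
  have h1 : f1 * m * L <= (- (f2 / 4) * (e ^+ 2 / 2) + f1 * (3 * (e / w) ^+ 2 / 2)) * L.
    rewrite -mulrA mE mulrDr mulrDl; apply: lerD; first by rewrite mulrA ler_pM2r.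
    rewrite [leRHS](_ : _ = f1 * (3 * (e / w) ^+ 2 / 2 * L)); last by ring.
    rewrite ler_pM2l//; apply: le_trans hP _; lra.
  have h2 : - (f2 / 4) * (e ^+ 2 / 2) + f1 * (3 * (e / w) ^+ 2 / 2) < 0.
    have -> : - (f2 / 4) * (e ^+ 2 / 2) + f1 * (3 * (e / w) ^+ 2 / 2) =
      (e / w) ^+ 2 / 8 * (12 * f1 - f2 * w ^+ 2) by field; rewrite gt_eqF.
    by rewrite pmulr_rlt0 ?subr_lt0// divr_gt0// exprn_gt0// divr_gt0.
  have h3 : f1 * m * L < 0.
    by apply: le_lt_trans h1 _; rewrite pmulr_llt0.
  by move: h3; rewrite pmulr_llt0// pmulr_rlt0.
rewrite /m sE in m0; rewrite ltr_pdivrMr// -mulrA -expr2 sE; lra.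
Qed.

(** * Failure of local maximality: the lowest mode *)

Lemma wave_lower {R : realType} (L lambda m e t : R) p : riccati L lambda m (wave L 1 e t) p -> 0 < e ->
  t <= m /\ e ^+ 2 / 2 <= (m - t) * (freq L 1 ^+ 2 + 4 * lambda ^+ 2 + 2 * e).
Proof.
move=> rp e0; have [L0 bv dp pL Ip] := rp; have bp := primitive_on_bddmeas dp.
have mE := riccati_mean rp; have [w1 _] := wave_int e t L0 (ltn0Sn 0); rewrite w1 in mE.
set P := Int 0 L (fun x => p x ^+ 2) in mE.
have P0 : 0 <= P by apply: Rintegral_ge0 => x _; exact: sqr_ge0.
split; first by rewrite -(ler_pM2r L0) mE; lra.
have [c1 s1 c2 s2 sc] := Int_freq L0 (ltn0Sn 0).
set w := freq L 1 in c1 s1 c2 s2 sc *.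
have w0 : 0 < w by exact: freq_gt0.
have bc : bddmeas 0 L (fun x => cos (w * x)) by apply: bddmeas_cont; exact: cosM_continuous.
have bs : bddmeas 0 L (fun x => sin (w * x)) by apply: bddmeas_cont; exact: sinM_continuous.
have dw : primitive_on 0 L (fun x => (-1) * cos (w * x)) (fun x => w * sin (w * x)).
  apply: primitive_on_C1T => x; last by apply: cvgM; [exact: cvg_cst|exact: sinM_continuous].
  by apply: is_derive_eq; rewrite /GRing.scale/=; ring.
pose Q := w ^+ 2 + 4 * lambda ^+ 2.
have Q0 : 0 < Q by rewrite /Q ltr_wpDr ?exprn_gt0// mulr_ge0 ?sqr_ge0.
(* tau = e / Q maximises tau e L - tau^2 Q L / 2, the lower bound obtained from the test function w
   = - cos. *)
have tau0 : 0 <= e / Q by rewrite divr_ge0// ltW.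
have wL : (-1) * cos (w * 0) = (-1) * cos (w * L) by rewrite /w cos_freqL// mulr0 cos0.
have Iw : Int 0 L (fun x => (-1) * cos (w * x)) = 0 by rewrite IntZ// c1 mulr0.
have we x : 0 <= x <= L -> (-1) * cos (w * x) <= 1.
  by move=> _; have := cos_geN1 (w * x); lra.
have := riccati_lower rp dw wL Iw tau0 we.
have -> : Int 0 L (fun x => wave L 1 e t x * (-1 * cos (w * x))) = - (e * L / 2).
  rewrite (@eq_Int _ _ _ _ (fun x => (- e) * cos (w * x) ^+ 2 + (- t) * cos (w * x))).
    rewrite IntD; [|by bddmeas_tac..]; rewrite !IntZ; [|by bddmeas_tac..]; rewrite c1 c2; ring.
  by move=> x _; rewrite /wave -/w; ring.
have -> : Int 0 L (fun x => (2 * lambda * (-1 * cos (w * x)) - w * sin (w * x)) ^+ 2) = Q * L / 2.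
  rewrite (@eq_Int _ _ _ _ (fun x => (4 * lambda ^+ 2) * cos (w * x) ^+ 2 + w ^+ 2 * sin (w * x) ^+ 2
     + (4 * lambda * w) * (sin (w * x) * cos (w * x)))).
    rewrite !IntD; [|by bddmeas_tac..]; rewrite !IntZ; [|by bddmeas_tac..]; rewrite c2 s2 sc /Q; by ring.
  by move=> x _; ring.
rewrite -/P mulr1 => h.
have PE : P = (m - t) * L by rewrite mulrBl mE; ring.
rewrite PE in h.
have {}h : e ^+ 2 / 2 * (L / Q) <= (m - t) * (Q + 2 * e) * (L / Q).
  rewrite (_ : e ^+ 2 / 2 * (L / Q) = - 2 * (e / Q) * - (e * L / 2) - (e / Q) ^+ 2 * (Q * L / 2)); last by field; lra.
  rewrite (_ : (m - t) * (Q + 2 * e) * (L / Q) = (1 + 2 * (e / Q)) * ((m - t) * L))//; field; lra.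
by move: h; rewrite ler_pM2r// divr_gt0.
Qed.

Lemma riccati_constant_ge {R : realType} (L lambda m eta : R) (v p : R -> R) :
  riccati L lambda m v p -> (forall x, 0 <= x <= L -> `|v x| <= eta) -> - eta <= m.
Proof.
move=> rp ve; have [L0 bv _ _ _] := rp; have mE := riccati_mean rp.
have P0 : 0 <= Int 0 L (fun x => p x ^+ 2) by apply: Rintegral_ge0 => x _; exact: sqr_ge0.
have : Int 0 L (fun=> - eta) <= Int 0 L v.
  apply: le_Int => //; first exact: bddmeas_cst.
  by move=> x /ve /ler_normlP[h1 h2]; rewrite lerNl.
rewrite Int_cst ?(ltW L0)// subr0 => h.
by rewrite -(ler_pM2r L0) mE; apply: le_trans h _; rewrite lerDl.
Qed.

(** From - k >= l^2 + b0 / 2 the speed is at least l and at least b0 / (2 l), so it is large at both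
    ends of the half-line and a compact interval suffices. *)
Lemma speed_minimum_exists {R : realType} (L b0 eta : R) (v : R -> R) : 0 < L -> 0 < b0 ->
  bddmeas 0 L v -> 0 < eta -> (forall x, `|v x| <= eta) -> eta <= b0 / 2 ->
  (forall l, 0 < l -> exists k, is_principal_eigenvalue L l (fun x => b0 + v x) k) ->
  exists2 l0, 0 < l0 & forall l, 0 < l ->
    - principal_eigenvalue L l0 (fun x => b0 + v x) / l0 <=
    - principal_eigenvalue L l (fun x => b0 + v x) / l.
Proof.
move=> L0 b00 bv e0 ve e2 pex.
have [k kE] : exists k : R -> R, forall l, principal_eigenvalue L l (fun x => b0 + v x) = k l.
  by exists (fun l => principal_eigenvalue L l (fun x => b0 + v x)).
have pk l : 0 < l -> is_principal_eigenvalue L l (fun x => b0 + v x) (k l).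
  by move=> l0; have [k0 h] := pex l l0; rewrite -kE; exact: principal_eigenvalueP h.
have low l : 0 < l -> l ^+ 2 + b0 / 2 <= - k l.
  move=> l0; have [p [psi [rp _ _]]] := eigen_riccati L0 (pk l l0) bv (ae_refl (fun x => b0 + v x)).
  by have := riccati_constant_ge rp (fun x _ => ve x); lra.
pose phi l := - k l / l.
have low1 l : 0 < l -> l <= phi l.
  by move=> l0; rewrite /phi ler_pdivlMr// -expr2; have := low l l0; lra.
have low2 l : 0 < l -> b0 / 2 / l <= phi l.
  move=> l0; rewrite /phi ler_pM2r ?invr_gt0//; have := low l l0; have := sqr_ge0 l; lra.
have V1 : 1 <= phi 1 by exact: low1.
(* Outside [[A, B]] the two lower bounds exceed the value at 1, and 1 lies in [[A, B]]. *)
pose B := phi 1 + 1.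
pose A := Num.min 1 (b0 / 2 / B).
have B0 : 0 < B by rewrite /B; lra.
have A0 : 0 < A by rewrite lt_min ltr01 !divr_gt0.
have A1 : A <= 1 by rewrite ge_min lexx.
have AB : A * B <= b0 / 2 by rewrite -ler_pdivlMr// ge_min lexx orbT.
have AleB : A <= B by rewrite /B; lra.
have ck : {within `[A, B], continuous k}.
  have K0 : 0 <= 2 * (B + eta * L) + B by have := mulr_gt0 e0 L0; lra.
  apply: (lipschitz_within K0) => x y Ax xy yB.
  have x0 : 0 < x by lra.
  have y0 : 0 < y by lra.
  have xB : 0 < x <= B by apply/andP; split; lra.
  have yB' : 0 < y <= B by apply/andP; split; lra.
  have := eigenvalue_dist L0 yB' xB e0 (fun x _ => ve x) (pk y y0) (pk x x0) bv (ae_refl (fun x => b0 + v x)).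
  rewrite (ger0_norm (_ : 0 <= y - x)) ?subr_ge0// => h; apply: le_trans h _.
  have : (y - x) ^+ 2 <= B * (y - x) by rewrite expr2 ler_wpM2r ?subr_ge0//; lra.
  lra.
have cphi : {within `[A, B], continuous phi}.
  have cinv : {within `[A, B], continuous (fun l : R => l^-1)}.
    apply: continuous_in_subspaceT => l; rewrite inE /= in_itv /= => lAB.
    by apply: cvgV; [apply: lt0r_neq0; lra|exact: cvg_id].
  by move=> l; apply: cvgM; [apply: cvgN; exact: ck|exact: cinv].
have [l0 l0AB Hmin] := EVT_min AleB cphi.
have l0p : 0 < l0 by move: l0AB; rewrite in_itv /=; lra.
have phi1 : phi l0 <= phi 1 by apply: Hmin; rewrite in_itv /=; apply/andP; split; rewrite /B; lra.
exists l0 => // l lp; rewrite !kE -/(phi l) -/(phi l0).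
have [lA|Al] := ltP l A.
  apply: le_trans phi1 _; apply: le_trans (low2 l lp).
  rewrite ler_pdivlMr//; apply: le_trans AB; apply: le_trans (_ : B * l <= _).
    by rewrite ler_pM2r// /B; lra.
  by rewrite mulrC ler_pM2r// ltW.
have [lB|Bl] := leP l B; first by apply: Hmin; rewrite in_itv /= Al.
apply: le_trans phi1 _; apply: le_trans (low1 l lp); rewrite /B in Bl; lra.
Qed.

Lemma exists_small {R : realType} (s : seq R) : all (fun x => 0 < x) s ->
  exists2 e, 0 < e & all (fun x => e <= x) s.
Proof.
elim: s => [_|x s IH /= /andP[x0 /IH[e e0 es]]]; first by exists 1.
exists (Num.min x e); first by rewrite lt_min x0.
rewrite /= ge_min lexx /=; apply: sub_all es => y ey.
by rewrite ge_min ey orbT.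
Qed.

Lemma choose_gap_wave {R : realType} (a Q f1 : R) : 0 < a -> 0 < Q -> a * Q < f1 ->
  exists delta : R, [/\ 0 < delta, delta <= a & (a + delta) * (1 + delta) * (Q + delta) < f1].
Proof.
move=> a0 Q0 gap; pose K := a + (a + 2) * (Q + 1).
have K0 : 0 < K by rewrite /K addr_gt0// mulr_gt0// addr_gt0.
pose delta := Num.min (Num.min 1 a) ((f1 - a * Q) / (2 * K)).
have d0 : 0 < delta by rewrite !lt_min ltr01 a0 /= divr_gt0 ?subr_gt0// mulr_gt0.
have d1 : delta <= 1 by rewrite !ge_min lexx.
have d2 : delta <= a by rewrite !ge_min lexx !orbT.
have d3 : delta * (2 * K) <= f1 - a * Q by rewrite -ler_pdivlMr ?mulr_gt0// !ge_min lexx !orbT.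
exists delta; split => //.
have h1 : (a + delta) * (1 + delta) <= a + delta * (a + 2).
  have : delta * delta <= delta * 1 by rewrite ler_pM2l.
  lra.
have h2 : (a + delta) * (1 + delta) * (Q + delta) <= (a + delta * (a + 2)) * (Q + delta).
  by rewrite ler_pM2r// addr_gt0.
have h3 : delta * (a + 2) * (Q + delta) <= delta * (a + 2) * (Q + 1).
  by rewrite ler_pM2l; [lra|rewrite mulr_gt0//; lra].
apply: le_lt_trans h2 _; rewrite /K in d3.
have : 0 < delta * (a + (a + 2) * (Q + 1)) by rewrite mulr_gt0.
lra.
Qed.

(** A bootstrap: |t| <= e first gives - t <= C e^2, which makes t^2 of order e^3 and hence at most
    delta e^2 / 2; the constraint then yields the nearly sharp constant [A]. *)
Lemma wave_drift {R : realType} (a delta f1 e t : R)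
  (A := (a + delta) * (1 + delta) / f1) (C := (a + delta) * (3 / 2) / f1) :
  0 < a -> 0 < delta -> 0 < f1 -> 0 < e -> e * (2 * C) <= delta -> - e <= t <= 0 ->
  `|f1 * t + a * (e ^+ 2 / 2 + t ^+ 2)| <= delta * (e ^+ 2 / 2 + t ^+ 2) ->
  - (A * (e ^+ 2 / 2)) <= t.
Proof.
move=> a0 d0 f10 e0 e5 te tb.
have C0 : 0 < C by rewrite divr_gt0// mulr_gt0 ?divr_gt0// addr_gt0.
have /andP[te1 te2] := te.
have /ler_normlP[_ tb'] := tb; have /ler_normlP[tb1 _] := tb.
have t2 : t ^+ 2 <= e ^+ 2.
  by rewrite -(sqrrN t) lerXn2r ?nnegrE; lra.
have X0 : 0 < a + delta by rewrite addr_gt0.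
have tC : - t <= C * e ^+ 2.
  rewrite -(ler_pM2l f10) (_ : f1 * (C * e ^+ 2) = (a + delta) * (3 / 2 * e ^+ 2)); last first.
    by rewrite /C; field; rewrite gt_eqF.
  have : (a + delta) * (e ^+ 2 / 2 + t ^+ 2) <= (a + delta) * (3 / 2 * e ^+ 2).
    by rewrite ler_pM2l//; lra.
  lra.
have t3 : t ^+ 2 <= delta * (e ^+ 2 / 2).
  have h1 : t ^+ 2 <= e * (C * e ^+ 2).
    rewrite -(sqrrN t) expr2; apply: ler_pM => //; lra.
  have h2 : e * (2 * C) * (e ^+ 2 / 2) <= delta * (e ^+ 2 / 2).
    by rewrite ler_wpM2r// divr_ge0// sqr_ge0.
  lra.
rewrite -(ler_pM2l f10) (_ : f1 * - _ = - ((a + delta) * ((1 + delta) * (e ^+ 2 / 2)))); last first.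
  by rewrite /A; field; rewrite gt_eqF.
have : (a + delta) * (e ^+ 2 / 2 + t ^+ 2) <= (a + delta) * ((1 + delta) * (e ^+ 2 / 2)).
  by rewrite ler_pM2l//; lra.
lra.
Qed.

(** Two regimes make the bound uniform in [l]. For |l - s| >= r the square beats the loss, at most
    r^2 / 2, allowed by m >= t. For |l - s| < r the weight at [l] is within [delta] of [Q], and A (Q
    + delta) < 1 forces m > 0. *)
Lemma wave_gap {R : realType} (w s r delta A e b0 t m l : R) (Q := w ^+ 2 + 4 * b0) :
  0 < w -> 0 < s -> 0 < r -> r <= s -> 0 < delta -> 0 < A -> 0 < e -> 0 < e ^+ 2 / 2 ->
  s ^+ 2 = b0 -> A * (Q + delta) < 1 -> r * (24 * s) <= delta -> e <= delta / 4 -> e <= r ->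
  e * A <= r -> 0 < l -> - (A * (e ^+ 2 / 2)) <= t -> t <= m ->
  e ^+ 2 / 2 <= (m - t) * (w ^+ 2 + 4 * l ^+ 2 + 2 * e) ->
  0 < (l - s) ^+ 2 + m.
Proof.
move=> w0 s0 r0 rs d0 A0 e0 e2p sE AQ rd e6 e7 e8 l0 tA tm me.
have [lr|rl] := ltP `|l - s| r; last first.
  have h1 : r ^+ 2 <= (l - s) ^+ 2.
    by rewrite -(real_normK (num_real (l - s))) lerXn2r ?nnegrE// ltW.
  have h2 : A * (e ^+ 2 / 2) <= r * r / 2.
    have : (e * A) * e <= r * r by apply: ler_pM => //; [apply: mulr_ge0; exact: ltW|exact: ltW].
    lra.
  have : 0 < r * r by rewrite mulr_gt0.
  rewrite expr2 in h1; lra.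
have /ltr_normlP[l1 l2] := lr.
(* Here l + s <= 3 s, so 4 (l^2 - b0) <= 12 r s <= delta / 2, and 2 e takes the other half. *)
have Ql : w ^+ 2 + 4 * l ^+ 2 + 2 * e <= Q + delta.
  have h : l ^+ 2 - b0 <= r * (3 * s).
    rewrite -sE subr_sqr; have [ls|sl] := leP l s.
      have : (l - s) * (l + s) <= 0 by apply: mulr_le0_ge0; [rewrite subr_le0|apply: addr_ge0; exact: ltW].
      have : 0 < r * (3 * s) by rewrite !mulr_gt0.
      lra.
    apply: ler_pM; lra.
  rewrite /Q; lra.
have Qp : 0 < w ^+ 2 + 4 * l ^+ 2 + 2 * e.
  by have := exprn_gt0 2 w0; have := exprn_gt0 2 l0; lra.
set X := w ^+ 2 + 4 * l ^+ 2 + 2 * e in me Ql Qp.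
have h1 : t * X >= - (A * (e ^+ 2 / 2)) * X by rewrite ler_pM2r.
have h2 : A * X < 1 by apply: le_lt_trans AQ; rewrite ler_pM2l.
have h3 : (e ^+ 2 / 2) * (A * X) < e ^+ 2 / 2 * 1 by rewrite ltr_pM2l.
have h4 : 0 < m * X by lra.
rewrite pmulr_lgt0// in h4.
by have := sqr_ge0 (l - s); lra.
Qed.

Lemma not_local_max_core {R : realType} (L beta b0 f1 f2 : R) (f : R -> R) : 0 < L -> 0 < b0 -> f b0 = beta ->
  {in `[0, +oo[ &, {homo f : x y / x < y}} ->
  (forall x, 0 < x -> derivable f x 1 /\ derivable (derive1 f) x 1) -> 0 < f1 -> 0 < f2 ->
  (forall eps, 0 < eps -> exists2 eta, 0 < eta & taylor_bound f b0 f1 f2 eps eta) ->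
  2 * f2 * (pi ^+ 2 / L ^+ 2 + b0) - f1 < 0 ->
  ~ local_maximizer (minimal_speed L) (admissible f L beta) (cst b0).
Proof.
move=> L0 b00 fb0 finc df f10 f20 T D0 [eta0 eta00 H].
pose s := Num.sqrt b0.
have s0 : 0 < s by rewrite sqrtr_gt0.
have sE : s ^+ 2 = b0 by rewrite sqr_sqrtr// ltW.
pose w : R := freq L 1.
have w0 : 0 < w by exact: freq_gt0.
pose Q := w ^+ 2 + 4 * b0.
have Q0 : 0 < Q by rewrite addr_gt0 ?exprn_gt0// mulr_gt0.
have gapQ : f2 / 2 * Q < f1.
  rewrite -subr_lt0 (_ : _ - f1 = 2 * f2 * (pi ^+ 2 / L ^+ 2 + b0) - f1)//.
  by rewrite /Q /w /freq; move: (pi : R) => c; field; rewrite gt_eqF.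
have a0 : 0 < f2 / 2 by rewrite divr_gt0.
have [delta [d0 da gap]] := choose_gap_wave a0 Q0 gapQ.
pose A := (f2 / 2 + delta) * (1 + delta) / f1.
have A0 : 0 < A by rewrite divr_gt0// mulr_gt0// addr_gt0.
have AQ : A * (Q + delta) < 1.
  by rewrite /A mulrAC ltr_pdivrMr// mul1r.
pose C := (f2 / 2 + delta) * (3 / 2) / f1.
have C0 : 0 < C by rewrite divr_gt0// mulr_gt0 ?divr_gt0// addr_gt0.
have [eta1 eta10 T1] := T _ d0.
pose r := Num.min s (delta / (24 * s)).
have r0 : 0 < r by rewrite lt_min s0 divr_gt0// mulr_gt0.
have rs : r <= s by rewrite ge_min lexx.
have rd : r * (24 * s) <= delta by rewrite -ler_pdivlMr ?mulr_gt0// ge_min lexx orbT.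
(* In order, the entries serve closeness to b0, the Taylor estimate, positivity, existence of
   eigenvalues, the drift bootstrap, and the last three the two regimes in [l]. *)
have [e e0 /= /and5P[e1 e2 e3 e4 /and5P[e5 e6 e7 e8 _]]] : exists2 e, 0 < e &
    all (fun x => e <= x) [:: eta0 / 2; eta1 / 2; b0 / 4; (200 * L ^+ 2)^-1;
                              delta / (2 * C); delta / 4; r; r / A].
  have q1 : 0 < eta0 / 2 by exact: divr_gt0.
  have q2 : 0 < eta1 / 2 by exact: divr_gt0.
  have q3 : 0 < b0 / 4 by exact: divr_gt0.
  have q4 : 0 < (200 * L ^+ 2)^-1 by rewrite invr_gt0; apply: mulr_gt0 => //; exact: exprn_gt0.
  have q5 : 0 < delta / (2 * C) by apply: divr_gt0 => //; exact: mulr_gt0.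
  have q6 : 0 < delta / 4 by exact: divr_gt0.
  have q7 : 0 < r / A by exact: divr_gt0.
  by apply: exists_small; rewrite /= q1 q2 q3 q4 q5 q6 q7 r0.
have C20 : 0 < 2 * C by exact: mulr_gt0.
rewrite ler_pdivlMr// in e5; rewrite ler_pdivlMr// in e8.
have e9 : 2 * e <= (100 * L ^+ 2)^-1.
  have -> : (100 * L ^+ 2)^-1 = 2 * (200 * L ^+ 2)^-1 by field; rewrite gt_eqF.
  by rewrite ler_pM2l.
have ee1 : 2 * e <= eta1 by lra.
have ee0 : 2 * e <= eta0 by lra.
have eeb : 2 * e <= b0 / 2 by lra.
have e20 : 0 < 2 * e by rewrite mulr_gt0.
have [t [te bA tb]] := wave_admissible L0 (ltn0Sn 0) b00 fb0 finc df T1 da e0 ee1 eeb.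
have := H _ bA (le_trans (wave_dist L 1 b0 (ltW e0) te) _).
rewrite lee_fin => /(_ ee0); rewrite minimal_speed_cst//.
apply/negP; rewrite -ltNge -/s.
set b := fun x => b0 + wave L 1 e t x.
have tA : - (A * (e ^+ 2 / 2)) <= t by exact: (wave_drift a0 d0 f10 e0 e5 te tb).
have lower l k : 0 < l -> is_principal_eigenvalue L l b k -> 2 * s < - k / l.
  move=> l0 pe.
  have bw : bddmeas 0 L (wave L 1 e t) by apply: bddmeas_cont; exact: wave_continuous.
  have [p [psi [rp _ _]]] := eigen_riccati L0 pe bw (ae_refl b).
  have [tm me] := wave_lower rp e0.
  rewrite -/w in me; set m := - k - l ^+ 2 - b0 in tm me.
  rewrite ltr_pdivlMr// -subr_gt0.
  (* The excess over the constant speed splits into a detuning term and the Riccati constant. *)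
  have -> : - k - 2 * s * l = (l - s) ^+ 2 + m by rewrite /m -sE; ring.
  have e2p : 0 < e ^+ 2 / 2 by rewrite divr_gt0// exprn_gt0.
  exact: (wave_gap w0 s0 r0 rs d0 A0 e0 e2p sE AQ rd e6 e7 e8 l0 tA tm me).
have wb x := wave_bound L 1 x (ltW e0) te.
(* Existence is required at every [l]: a missing eigenvalue would count as 0 and give a speed 0
   below 2 s. *)
have pex l : 0 < l -> exists k, is_principal_eigenvalue L l b k.
  move=> lp; exact: (principal_eigenvalue_exists b0 L0 lp (@wave_continuous R L 1 e t) (wave_periodic 1 e t L0) wb e9).
have [l0 l0p Hl] := speed_minimum_exists L0 b00 (bddmeas_cont 0 L (@wave_continuous R L 1 e t)) e20 wb eeb pex.
rewrite (speed_attained l0p Hl); apply: lower => //.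
by have [k pk] := pex l0 l0p; exact: principal_eigenvalueP pk.
Qed.

Theorem theorem2p6 (R : realType) (L beta : R) (f : R -> R)
  (L_gt0 : 0 < L) (beta_gt0 : 0 < beta)
  (f_incr : {in `[0, +oo[ &, {homo f : x y / x < y}})
  (f_C2 : forall x : R, 0 < x ->
     [/\ derivable f x 1, derivable (derive1 f) x 1 &
         {for x, continuous (derive1n 2 f)}])
  (beta_im : (f @` `]0, +oo[) beta)
  (f2_gt0 : 0 < derive1n 2 f (inv_nonneg f beta)) :
  (0 < Dbeta f L beta ->
     strict_local_maximizer (minimal_speed L) (admissible f L beta)
       (cst (inv_nonneg f beta)))
  /\
  (Dbeta f L beta < 0 ->
     ~ local_maximizer (minimal_speed L) (admissible f L beta)
         (cst (inv_nonneg f beta))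
     /\
     ~ local_minimizer (minimal_speed L) (admissible f L beta)
         (cst (inv_nonneg f beta))).
Proof.
set b0 := inv_nonneg f beta in f2_gt0 *.
have [b00 fb0] : 0 < b0 /\ f b0 = beta by exact: inv_nonnegP.
have df x : 0 < x -> derivable f x 1 /\ derivable (derive1 f) x 1.
  by move=> /f_C2[].
have T : forall eps, 0 < eps -> exists2 eta, 0 < eta &
    taylor_bound f b0 (derive1 f b0) (derive1n 2 f b0) eps eta.
  apply: taylor2; last by have [] := f_C2 _ b00.
  by near=> x; apply: df; near: x; exact: lt_nbhsr.
have f1_gt0 : 0 < derive1 f b0 by exact: derive1_gt0_strict T.
split=> [D_gt0|D_lt0].
  apply: (local_max_core L_gt0 b00 fb0 _ f1_gt0 f2_gt0 T) => // x /df[dfx _].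
  by apply: differentiable_continuous; exact/derivable1_diffP.
split.
  exact: (not_local_max_core L_gt0 b00 fb0 f_incr df f1_gt0 f2_gt0 T D_lt0).
exact: (not_local_min_core L_gt0 b00 fb0 f_incr df f1_gt0 f2_gt0 T).
Unshelve. all: by end_near. Qed.
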